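(* Let $R$ be a ring. Then the following statements are equivalent. (1) $R$ is a $\tau_q$-semisimple ring. (2) Every $R$-module is $\tau_q$-projective. (3) $\mathrm{T}(R[x])$ is a semisimple ring. (4) $R[x]$ is a reduced ring with finitely many minimal primes. (5) $\mathrm{T}(R)$ is a semisimple ring. (6) $R$ is a reduced ring with finitely many minimal primes. (7) Every reg-injective $R$-module is injective. (8) Every semireg-injective $R$-module is injective. (9) Every Lucas $R$-module is injective. (10) Every strongly Lucas $R$-module is injective. (11) $\mathcal{Q}_0(R)$ is a semisimple ring.
   Context: All rings are commutative with identity. $\mathrm{T}(A)$ denotes the total ring of quotients of a ring $A$, and $R[x]$ the polynomial ring. An ideal $I$ of $R$ is dense if $(0:_R I)=\{r\in R: Ir=0\}=0$, regular if it contains a non-zero-divisor, and semi-regular if it contains a finitely generated dense ideal. $\mathcal{Q}$ denotes the set of finitely generated semi-regular ideals of $R$. The ring of finite fractions is $\mathcal{Q}_0(R)=\{\alpha\in \mathrm{T}(R[x]) : I\alpha\subseteq R\text{ for some }I\in\mathcal Q\}$. An $R$-module $M$ is $\mathcal Q$-torsion-free if $Im=0$ with $I\in\mathcal Q$, $m\in M$ implies $m=0$. An $R$-module $M$ is reg-injective if $\mathrm{Ext}^1_R(R/I,M)=0$ for every regular ideal $I$ of $R$, and semireg-injective if $\mathrm{Ext}^1_R(R/I,M)=0$ for every semi-regular ideal $I$ of $R$. A $\mathcal Q$-torsion-free module $M$ is a Lucas module if $\mathrm{Ext}^1_R(R/I,M)=0$ for every $I\in\mathcal Q$, and a strongly Lucas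 module if $\mathrm{Ext}^n_R(R/I,M)=0$ for every $I\in\mathcal Q$ and every $n\ge1$. An $R$-module $P$ is $\tau_q$-projective if $\mathrm{Ext}^1_R(P,N)=0$ for every strongly Lucas $R$-module $N$. The $\tau_q$-projective dimension $\tau_q\text{-pd}_R(M)$ is the least $n\ge 0$ such that there is an exact sequence $0\to P_n\to\cdots\to P_0\to M\to 0$ with all $P_i$ $\tau_q$-projective ($\infty$ if none exists), and $\tau_q\text{-gl.dim}(R)=\sup\{\tau_q\text{-pd}_R(M): M\text{ an }R\text{-module}\}$. $R$ is $\tau_q$-semisimple if $\tau_q\text{-gl.dim}(R)=0$. *)

(* Defs.v *)
From HB Require Import structures.
From mathcomp Require Import all_boot all_algebra.
From mathcomp Require Import boolp.
From mathcomp Require Import ring.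

Set Implicit Arguments.
Unset Strict Implicit.
Unset Printing Implicit Defensive.

Import GRing.Theory.
Local Open Scope ring_scope.
Local Open Scope quotient_scope.

(* Submodules of V are represented by submodClosed V, ideals of R by
   submodClosed R^o.  Their membership predicates are boolean; under the
   classical axioms of boolp this is no restriction. *)

Section QuotientModule.
Variables (R : pzRingType) (V : lmodType R) (N : submodClosed V).

Fact submod_zmod_subproof : zmod_closed (N : {pred V}).
Proof. by apply: GRing.submod_closedB; apply: submodClosedP. Qed.

Definition submod_zmod : zmodClosed V :=
  HB.pack (N : {pred V})
    (GRing.isZmodClosed.Build V (N : {pred V}) submod_zmod_subproof).

Definition quotmod := Quotient.quot submod_zmod.

HB.instance Definition _ : EqQuotient V (Quotient.equiv submod_zmod) quotmod :=
  EqQuotient.on quotmod.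
HB.instance Definition _ := GRing.Zmodule.on quotmod.

Definition quotmod_proj (x : V) : quotmod := \pi_quotmod x.

Lemma quotmod_eqP x y : reflect (quotmod_proj x = quotmod_proj y) (x - y \in N).
Proof.
rewrite (_ : (x - y \in N) = (x == y %[mod quotmod])); first exact: eqP.
exact: (Quotient.idealrBE submod_zmod).
Qed.

Lemma quotmod_projD x y :
  quotmod_proj (x + y) = quotmod_proj x + quotmod_proj y.
Proof. exact: (Quotient.pi_add submod_zmod). Qed.

Definition quotmod_scale (a : R) (x : quotmod) : quotmod :=
  quotmod_proj (a *: repr x).

Lemma quotmod_projZ a x :
  quotmod_proj (a *: x) = quotmod_scale a (quotmod_proj x).
Proof.
apply/quotmod_eqP; rewrite -scalerBr rpredZ //.
by apply/quotmod_eqP; rewrite /quotmod_proj reprK.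
Qed.

Lemma quotmod_projK x : quotmod_proj (repr x) = x.
Proof. by rewrite /quotmod_proj reprK. Qed.

Fact quotmod_scaleA a b x :
  quotmod_scale a (quotmod_scale b x) = quotmod_scale (a * b) x.
Proof.
by rewrite -(quotmod_projK x) -!quotmod_projZ scalerA.
Qed.

Fact quotmod_scale1 : left_id 1 quotmod_scale.
Proof. by move=> x; rewrite -(quotmod_projK x) -quotmod_projZ scale1r. Qed.

Fact quotmod_scaleDr : right_distributive quotmod_scale +%R.
Proof.
move=> a x y; rewrite -(quotmod_projK x) -(quotmod_projK y).
by rewrite -quotmod_projD -!quotmod_projZ scalerDr quotmod_projD.
Qed.

Fact quotmod_scaleDl x : {morph quotmod_scale^~ x : a b / a + b}.
Proof.
move=> a b; rewrite -(quotmod_projK x).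
by rewrite -!quotmod_projZ scalerDl quotmod_projD.
Qed.

HB.instance Definition _ := GRing.Zmodule_isLmodule.Build R quotmod
  quotmod_scaleA quotmod_scale1 quotmod_scaleDr quotmod_scaleDl.

Fact quotmod_proj_linear : linear quotmod_proj.
Proof. by move=> a x y; rewrite quotmod_projD quotmod_projZ. Qed.

HB.instance Definition _ :=
  GRing.isLinear.Build R V quotmod *:%R quotmod_proj quotmod_proj_linear.

End QuotientModule.

Section Homological.
Variable R : pzRingType.
Implicit Types (M N P E A B : lmodType R) (n : nat).

Definition surjective_map (X Y : Type) (f : X -> Y) := forall y, exists x, f x = y.

Definition projective_mod P := forall M N (g : {linear M -> N}) (f : {linear P -> N}),
  surjective_map g -> exists h : {linear P -> M}, forall x, g (h x) = f x.

Definition injective_mod E := forall M N (i : {linear M -> N}) (f : {linear M -> E}),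
  injective i -> exists h : {linear N -> E}, forall x, h (i x) = f x.

(* An exact sequence ... -> X_2 -> X_1 -> X_0 -> M -> 0. *)
Record resolution M := Resolution {
  res_obj :> nat -> lmodType R;
  res_diff : forall n, {linear res_obj n.+1 -> res_obj n};
  res_aug : {linear res_obj 0%N -> M};
  res_aug_surj : surjective_map res_aug;
  res_exact0 : forall x, res_aug x = 0 <-> exists y, res_diff 0 y = x;
  res_exactS : forall n x, res_diff n x = 0 <-> exists y, res_diff n.+1 y = x
}.

(* H^n (Hom (X, B)) = 0 *)
Definition cohomology_vanishes A (X : resolution A) B n :=
  match n with
  | 0 => forall f : {linear X 0%N -> B},
      (forall y, f (res_diff X 0 y) = 0) -> forall x, f x = 0
  | m.+1 => forall f : {linear X m.+1 -> B},
      (forall y, f (res_diff X m.+1 y) = 0) ->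
      exists g : {linear X m -> B}, forall x, f x = g (res_diff X m x)
  end.

(* Ext^n_R (A, B) = 0.  The cohomology of Hom (X, B) does not depend on the
   projective resolution X of A, and free resolutions always exist. *)
Definition Ext_vanishes n A B :=
  forall X : resolution A, (forall i, projective_mod (X i)) ->
  cohomology_vanishes X B n.

Definition simple_submod M (S : submodClosed M) :=
  (exists2 x, x \in S & x != 0) /\
  forall K : submodClosed M, {subset K <= S} ->
    {subset S <= K} \/ {in K, forall x, x = 0}.

Definition direct_sum_of M (I : choiceType) (S : I -> submodClosed M) :=
  (forall x : M, exists s : seq I, exists2 f : I -> M,
     forall i, f i \in S i & x = \sum_(i <- s) f i) /\
  (forall (s : seq I) (f : I -> M), uniq s -> (forall i, f i \in S i) ->
     \sum_(i <- s) f i = 0 -> {in s, forall i, f i = 0}).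

Definition semisimple_mod M :=
  exists (I : choiceType) (S : I -> submodClosed M),
    (forall i, simple_submod (S i)) /\ direct_sum_of S.

End Homological.

Definition semisimple_ring (A : comNzRingType) := semisimple_mod A^o.

Definition reduced_ring (A : comNzRingType) :=
  forall (x : A) (n : nat), x ^+ n = 0 -> x = 0.

Definition minimal_prime (A : comNzRingType) (P : prime_idealr A) :=
  forall P' : prime_idealr A, {subset P' <= P} -> P' =i P.

Definition finitely_many_minimal_primes (A : comNzRingType) :=
  exists (n : nat) (P : 'I_n -> prime_idealr A),
    forall P' : prime_idealr A, minimal_prime P' -> exists i, P' =i P i.

(* The total ring of quotients: the construction of mathcomp's fraction.v with
   "nonzero" denominators replaced by non-zero-divisors. *)
Module TotalQuot.
Section TotalQuot.
Variable A : comNzRingType.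

Record ratio := Ratio { frac :> A * A; _ : `[< GRing.lreg frac.2 >] }.

#[export] HB.instance Definition _ := [isSub for frac].
#[export] HB.instance Definition _ := [Choice of ratio by <:].

Implicit Types x y z : ratio.

Lemma denomP x : GRing.lreg x.2. Proof. by case: x => f /= /asboolP. Qed.

Definition mk_ratio (a s : A) (hs : GRing.lreg s) : ratio :=
  @Ratio (a, s) (introT (asboolP _) hs).

Definition equivr x y := x.1 * y.2 == y.1 * x.2.

Fact equivr_refl : reflexive equivr.
Proof. by move=> x; rewrite /equivr. Qed.

Fact equivr_sym : symmetric equivr.
Proof. by move=> x y; rewrite /equivr eq_sym. Qed.

Fact equivr_trans : transitive equivr.
Proof.
move=> y x z /eqP xy /eqP yz; apply/eqP; apply: (@denomP y).
transitivity (x.1 * y.2 * z.2); first by ring.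
by rewrite xy mulrAC yz; ring.
Qed.

Canonical equivr_equiv := EquivRel equivr equivr_refl equivr_sym equivr_trans.

Definition type := {eq_quot equivr}.

#[export] HB.instance Definition _ : EqQuotient _ equivr type := EqQuotient.on type.
#[export] HB.instance Definition _ := Choice.on type.

Lemma pi_eqP x y : reflect (\pi_type x = \pi_type y) (x.1 * y.2 == y.1 * x.2).
Proof. by rewrite (_ : _ == _ = equivr x y) // -eqmodE; apply: eqP. Qed.

Lemma repr_eq x : (repr (\pi_type x)).1 * x.2 = x.1 * (repr (\pi_type x)).2.
Proof. by apply/eqP/pi_eqP; rewrite reprK. Qed.

Definition addf x y := mk_ratio (x.1 * y.2 + y.1 * x.2)
  (lregM (@denomP x) (@denomP y)).
Definition mulf x y := mk_ratio (x.1 * y.1) (lregM (@denomP x) (@denomP y)).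
Definition oppf x := mk_ratio (- x.1) (@denomP x).
Definition embf (a : A) := mk_ratio a (@lreg1 A).

Definition add (u v : type) : type := \pi_type (addf (repr u) (repr v)).
Definition mul (u v : type) : type := \pi_type (mulf (repr u) (repr v)).
Definition opp (u : type) : type := \pi_type (oppf (repr u)).
Definition emb (a : A) : type := \pi_type (embf a).

Lemma pi_add x y : add (\pi_type x) (\pi_type y) = \pi_type (addf x y).
Proof.
apply/pi_eqP => /=.
have ex := repr_eq x; have ey := repr_eq y.
move: (repr (\pi_type x)) (repr (\pi_type y)) ex ey => x' y' ex ey.
apply/eqP; transitivity (x'.1 * x.2 * (y.2 * y'.2) + y'.1 * y.2 * (x.2 * x'.2)).
  by ring.
by rewrite ex ey; ring.
Qed.

Lemma pi_mul x y : mul (\pi_type x) (\pi_type y) = \pi_type (mulf x y).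
Proof.
apply/pi_eqP => /=; apply/eqP.
by rewrite mulrACA !repr_eq [RHS]mulrACA.
Qed.

Lemma pi_opp x : opp (\pi_type x) = \pi_type (oppf x).
Proof. by apply/pi_eqP => /=; apply/eqP; rewrite !mulNr repr_eq. Qed.

Fact addA : associative add.
Proof.
elim/quotW=> x; elim/quotW=> y; elim/quotW=> z.
rewrite (pi_add y z) (pi_add x y) (pi_add x) (pi_add _ z).
by apply/pi_eqP => /=; apply/eqP; ring.
Qed.

Fact addC : commutative add.
Proof.
elim/quotW=> x; elim/quotW=> y; rewrite !pi_add; apply/pi_eqP => /=.
by rewrite addrC (mulrC x.2).
Qed.

Fact add0 : left_id (emb 0) add.
Proof.
elim/quotW=> x; rewrite pi_add; apply/pi_eqP => /=.
by rewrite mul0r add0r mulr1 mul1r.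
Qed.

Fact addN : left_inverse (emb 0) opp add.
Proof.
elim/quotW=> x; rewrite pi_opp pi_add; apply/pi_eqP => /=.
by rewrite mulNr addNr !mul0r.
Qed.

#[export] HB.instance Definition _ := GRing.isZmodule.Build type addA addC add0 addN.

Fact mulA : associative mul.
Proof.
elim/quotW=> x; elim/quotW=> y; elim/quotW=> z.
rewrite (pi_mul y z) (pi_mul x y) (pi_mul x) (pi_mul _ z).
by apply/pi_eqP => /=; rewrite !mulrA.
Qed.

Fact mulC : commutative mul.
Proof.
elim/quotW=> x; elim/quotW=> y; rewrite !pi_mul; apply/pi_eqP => /=.
by rewrite (mulrC x.1) (mulrC x.2).
Qed.

Fact mul1 : left_id (emb 1) mul.
Proof.
by elim/quotW=> x; rewrite pi_mul; apply/pi_eqP; rewrite /= !mul1r.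
Qed.

Fact mulD : left_distributive mul +%R.
Proof.
elim/quotW=> x; elim/quotW=> y; elim/quotW=> z.
rewrite /GRing.add /= (pi_add x y) (pi_mul _ z) (pi_mul x z) (pi_mul y z).
rewrite (pi_add (mulf x z)).
by apply/pi_eqP => /=; apply/eqP; ring.
Qed.

Fact one_neq0 : emb 1 != emb 0.
Proof.
by apply/eqP => /pi_eqP; rewrite /= !mulr1 (negPf (oner_neq0 A)).
Qed.

#[export] HB.instance Definition _ :=
  GRing.Zmodule_isComNzRing.Build type mulA mulC mul1 mulD one_neq0.

Fact emb_additive : zmod_morphism emb.
Proof.
move=> a b; rewrite /GRing.add /GRing.opp /= (pi_opp (embf b)).
rewrite (pi_add (embf a)); apply/pi_eqP => /=.
by rewrite !mulr1.
Qed.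

Fact emb_multiplicative : monoid_morphism emb.
Proof.
split=> // a b; rewrite /GRing.mul /= (pi_mul (embf a)); apply/pi_eqP => /=.
by rewrite !mulr1.
Qed.

#[export] HB.instance Definition _ := GRing.isZmodMorphism.Build A type emb emb_additive.
#[export] HB.instance Definition _ :=
  GRing.isMonoidMorphism.Build A type emb emb_multiplicative.

End TotalQuot.

Module Exports. HB.reexport. End Exports.
End TotalQuot.
Export TotalQuot.Exports.

Notation total_quot := TotalQuot.type.
Notation to_total_quot := TotalQuot.emb.

Section FiniteFractions.
Variable R : comNzRingType.
Implicit Types (I J : submodClosed R^o) (M N P : lmodType R).

Definition dense I := forall r : R, (forall i, i \in I -> i * r = 0) -> r = 0.

Definition finitely_generated I :=
  exists (n : nat) (g : 'I_n -> R), forall x : R,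
    x \in I <-> exists c : 'I_n -> R, x = \sum_(k < n) c k * g k.

Definition regular_ideal I := exists2 s : R, s \in I & GRing.lreg s.

Definition semiregular_ideal I :=
  exists J, [/\ {subset J <= I}, finitely_generated J & dense J].

Definition in_Q I := finitely_generated I /\ semiregular_ideal I.

Lemma in_Q_dense I : in_Q I -> dense I.
Proof. by case=> _ [J [sJI _ dJ]] r Ir; apply: dJ => j /sJI /Ir. Qed.

Definition finite_fraction (u : total_quot {poly R}) :=
  exists2 I, in_Q I & forall r : R, r \in I ->
    exists b : R, to_total_quot r%:P * u = to_total_quot b%:P.

Definition Q0_pred : {pred total_quot {poly R}} :=
  fun u => `[< finite_fraction u >].

Lemma mul_in_Q I J : in_Q I -> in_Q J -> exists K, in_Q K /\
  forall r, r \in K -> exists (n : nat) (a b : 'I_n -> R),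
    (forall k, a k \in I /\ b k \in J) /\ r = \sum_(k < n) a k * b k.
Proof.
move=> QI QJ; have [[m [g gI]] _] := QI; have [[n [h hJ]] _] := QJ.
pose gh (k : 'I_#|{: 'I_m * 'I_n}|) : R :=
  g (enum_val k).1 * h (enum_val k).2.
pose S (x : R^o) := `[< exists c : 'I_#|{: 'I_m * 'I_n}| -> R,
  x = \sum_k c k * gh k >].
have Slin : submod_closed (S : {pred R^o}).
  split.
    by apply/asboolP; exists (fun _ => 0); rewrite big1 // => k _; rewrite mul0r.
  move=> a u v /asboolP [c ->] /asboolP [d ->]; apply/asboolP.
  exists (fun k => a * c k + d k); rewrite scaler_sumr -big_split /=.
  by apply: eq_bigr => k _; rewrite mulrDl -mulrA.
pose K : submodClosed R^o :=
  HB.pack S (GRing.isSubmodClosed.Build R R^o S (GRing.submod_closed_semi Slin)).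
have KE (x : R) : x \in K <-> exists c : 'I_#|{: 'I_m * 'I_n}| -> R,
    x = \sum_k c k * gh k by split=> /asboolP.
have gin i : g i \in I.
  apply/gI; exists (fun k => (k == i)%:R); rewrite (bigD1 i) //= eqxx mul1r.
  by rewrite big1 ?addr0 // => k /negPf ->; rewrite mul0r.
have hin i : h i \in J.
  apply/hJ; exists (fun k => (k == i)%:R); rewrite (bigD1 i) //= eqxx mul1r.
  by rewrite big1 ?addr0 // => k /negPf ->; rewrite mul0r.
have ghK k : gh k \in K.
  apply/KE; exists (fun l => (l == k)%:R); rewrite (bigD1 k) //= eqxx mul1r.
  by rewrite big1 ?addr0 // => l /negPf ->; rewrite mul0r.
exists K; split; last first.
  move=> r /KE [c ->]; exists #|{: 'I_m * 'I_n}|.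
  exists (fun k => c k * g (enum_val k).1), (fun k => h (enum_val k).2).
  split=> [k|]; last by apply: eq_bigr => k _; rewrite mulrA.
  by split; [apply: (rpredZ (s := I)) | ].
have fK : finitely_generated K by exists #|{: 'I_m * 'I_n}|, gh.
split=> //; exists K; split=> // r Kr.
apply: (in_Q_dense QJ) => j /hJ [d ->]; rewrite mulr_suml big1 // => l _.
rewrite -mulrA (_ : h l * r = 0) ?mulr0 //.
apply: (in_Q_dense QI) => i /gI [c ->]; rewrite mulr_suml big1 // => k _.
rewrite -mulrA mulrA -mulrA [g k * _]mulrA.
have := ghK (enum_rank (k, l)); move/Kr; rewrite /gh enum_rankK /= => ->.
by rewrite mulr0.
Qed.

Fact Q0_subring : subring_closed Q0_pred.
Proof.
have emb_sum n (f : 'I_n -> R) : to_total_quot (\sum_k f k)%:P =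
    \sum_k to_total_quot (f k)%:P by rewrite !rmorph_sum.
split.
- pose S (x : R^o) := true.
  have Slin : submod_closed (S : {pred R^o}) by [].
  pose K : submodClosed R^o := HB.pack S
    (GRing.isSubmodClosed.Build R R^o S (GRing.submod_closed_semi Slin)).
  apply/asboolP; exists K; last by move=> r _; exists r; rewrite mulr1.
  have fK : finitely_generated K.
    exists 1%N, (fun _ => 1) => x; split=> // _; exists (fun _ => x).
    by rewrite big_ord1 mulr1.
  by split=> //; exists K; split=> // r /(_ 1 isT); rewrite mul1r.
- move=> u v /asboolP [I QI Iu] /asboolP [J QJ Jv]; apply/asboolP.
  have [K [QK KIJ]] := mul_in_Q QI QJ; exists K => // r.
  case/KIJ=> n [a [b [abIJ ->]]].
  have /choice [f fE] k : exists c : R, to_total_quot (a k * b k)%:P * (u - v) =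
      to_total_quot c%:P.
    have [/Iu [c cE] /Jv [d dE]] := abIJ k; exists (c * b k - a k * d).
    by rewrite polyCB !polyCM rmorphB !rmorphM /= -cE -dE; ring.
  exists (\sum_k f k); rewrite !emb_sum mulr_suml.
  by apply: eq_bigr => k _; rewrite fE.
- move=> u v /asboolP [I QI Iu] /asboolP [J QJ Jv]; apply/asboolP.
  have [K [QK KIJ]] := mul_in_Q QI QJ; exists K => // r.
  case/KIJ=> n [a [b [abIJ ->]]].
  have /choice [f fE] k : exists c : R, to_total_quot (a k * b k)%:P * (u * v) =
      to_total_quot c%:P.
    have [/Iu [c cE] /Jv [d dE]] := abIJ k; exists (c * d).
    by rewrite !polyCM !rmorphM /= -cE -dE mulrACA.
  exists (\sum_k f k); rewrite !emb_sum mulr_suml.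
  by apply: eq_bigr => k _; rewrite fE.
Qed.

HB.instance Definition _ :=
  GRing.isSubringClosed.Build (total_quot {poly R}) Q0_pred Q0_subring.

Record finite_fractions := FiniteFraction {
  finite_fraction_val :> total_quot {poly R};
  _ : finite_fraction_val \in Q0_pred
}.

HB.instance Definition _ := [isSub for finite_fraction_val].
HB.instance Definition _ := [Choice of finite_fractions by <:].
HB.instance Definition _ :=
  [SubChoice_isSubComNzRing of finite_fractions by <:].

Definition cyclic_mod I : lmodType R := quotmod I.

Definition Q_torsion_free M :=
  forall I (m : M), in_Q I -> (forall r : R, r \in I -> r *: m = 0) -> m = 0.

Definition reg_injective M :=
  forall I, regular_ideal I -> Ext_vanishes 1 (cyclic_mod I) M.

Definition semireg_injective M :=
  forall I, semiregular_ideal I -> Ext_vanishes 1 (cyclic_mod I) M.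

Definition Lucas_mod M :=
  Q_torsion_free M /\ forall I, in_Q I -> Ext_vanishes 1 (cyclic_mod I) M.

Definition strongly_Lucas_mod M :=
  Q_torsion_free M /\
  forall I n, in_Q I -> (1 <= n)%N -> Ext_vanishes n (cyclic_mod I) M.

Definition tauq_projective P :=
  forall N, strongly_Lucas_mod N -> Ext_vanishes 1 P N.

(* An exact sequence 0 -> P_n -> ... -> P_0 -> M -> 0 of tau_q-projective
   modules is an infinite exact sequence with P_i = 0 for i > n. *)
Definition has_tauq_resolution M n :=
  exists P : resolution M,
    (forall i, (i <= n)%N -> tauq_projective (P i)) /\
    (forall i, (n < i)%N -> forall x : P i, x = 0).

End FiniteFractions.

(* The least n with property p, None standing for infinity. *)
Definition least (p : nat -> Prop) : option nat :=
  if pselect (exists n, `[< p n >]) is left h then Some (ex_minn h) else None.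

Definition tauq_pd (R : comNzRingType) (M : lmodType R) : option nat :=
  least (has_tauq_resolution M).

(* The supremum in nat + {infinity}, as a least upper bound. *)
Definition tauq_gldim (R : comNzRingType) : option nat :=
  least (fun n => forall M : lmodType R,
    exists2 m, tauq_pd M = Some m & (m <= n)%N).

Definition tauq_semisimple (R : comNzRingType) := tauq_gldim R = Some 0%N.

(* Main.v *)
From HB Require Import structures.
Require Import Defs.
From mathcomp Require Import all_boot all_algebra.
From mathcomp Require Import boolp classical_sets.
From mathcomp Require Import ring freeg.

(* Everything is compared with the condition that finitely many primes of R have
   zero intersection.  It passes between R and R[x], is equivalent to "reduced
   with finitely many minimal primes", and is inherited from any semisimple
   overring of R.  Conversely, let p_1, ..., p_n be a minimal such family and
   pick x_i in all p_j (j <> i) but not in p_i.  Then s = x_1 + ... + x_n is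
   regular and the x_i / s are orthogonal idempotents cutting T(R), T(R[x]) and
   Q_0(R) into fields; moreover I + ann(I) is a direct sum containing a regular
   element for every ideal I, so extending maps from regular ideals is enough in
   Baer's criterion.  To come back from injectivity: if I contains a finitely
   generated dense ideal, then I generates the unit ideal of T(R[x]) by McCoy's
   theorem, and since Ext(R/I, -) is killed by I it vanishes on every
   T(R[x])-module.  So all these modules are injective over R.  For aT(R[x]) with
   a^2 = 0 this gives a = 0, and for a direct sum of copies of T(R[x]) it excludes
   infinite orthogonal sequences in R; a reduced ring without such sequences has
   finitely many primes with zero intersection. *)

Set Implicit Arguments.
Unset Strict Implicit.
Unset Printing Implicit Defensive.

Import GRing.Theory.
Local Open Scope ring_scope.
Local Open Scope quotient_scope.

(** * Covering by finitely many primes *)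

Section Primes.
Variable A : comNzRingType.
Implicit Types (I S : A -> Prop).

Lemma ex_prime_ideal S : S 0 -> ~ S 1 ->
  (forall a u v, S u -> S v -> S (a * u + v)) ->
  (forall u v, S (u * v) -> S u \/ S v) ->
  exists P : prime_idealr A, forall x, x \in P <-> S x.
Proof.
move=> S0 S1 Slin Sp; pose Sb (x : A) := `[< S x >].
have Sid : idealr_closed (Sb : {pred A}).
  split; first exact/asboolP.
    by apply/negP => /asboolP.
  by move=> a u v /asboolP Su /asboolP Sv; apply/asboolP/Slin.
have Spr : prime_idealr_closed (Sb : {pred A}).
  by move=> u v /asboolP /Sp [] ?; apply/orP; [left|right]; apply/asboolP.
pose P : prime_idealr A := HB.pack Sb
  (isIdealr.Build A Sb Sid) (isPrimeIdealrClosed.Build A Sb Spr).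
by exists P => x; split=> /asboolP.
Qed.

(** The form relative to a subset [I] is what the splitting argument below runs on. The family may
    be empty; it then covers only subsets of 0. *)
Definition covered I := exists (n : nat) (P : 'I_n -> prime_idealr A),
  forall x, I x -> (forall i, x \in P i) -> x = 0.

(** If no [P i] lay in [Q], a product of elements of the [P i] outside [Q] would lie in every [P i],
    hence be 0 and belong to [Q]. *)
Lemma covered_zero_product n (P : 'I_n -> prime_idealr A) (Q : prime_idealr A) :
  (forall x, (forall i, x \in P i) -> x = 0) -> exists i, {subset P i <= Q}.
Proof.
move=> P0; apply: contrapT => /forallNP nPQ.
have /choice [r rP] i : exists r, r \in P i /\ r \notin Q.
  apply: contrapT => nr; apply: (nPQ i) => x xP.
  by apply: contrapT => /negP xQ; apply: nr; exists x.
have : \prod_i r i \notin Q.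
  elim/big_ind: _ => [|u v|i _]; first by rewrite idealr1.
    by rewrite prime_idealrM negb_or => -> ->.
  exact: (rP i).2.
rewrite (P0 (\prod_i r i)) ?rpred0 // => i.
by rewrite (bigD1 i) //= mulrC idealMr // (rP i).1.
Qed.

Lemma covered_reduced_min : covered (fun=> True) ->
  reduced_ring A /\ finitely_many_minimal_primes A.
Proof.
case=> n [P P0].
have {}P0 x : (forall i, x \in P i) -> x = 0 by exact: P0.
split=> [x m xm|].
  apply: P0 => i; have : x ^+ m \in P i by rewrite xm rpred0.
  elim: m {xm} => [|m IH]; first by rewrite expr0 idealr1.
  by rewrite exprS prime_idealrM => /orP[].
exists n, P => P' mP'.
by have [i iP] := covered_zero_product P' P0; exists i => x; rewrite (mP' _ iP).
Qed.

(** The complement of a maximal multiplicative set that contains [a] and avoids 0 is the required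
    prime. *)
Lemma exists_minimal_prime : reduced_ring A -> forall a : A, a != 0 ->
  exists2 P, minimal_prime P & a \notin P.
Proof.
move=> red a a0.
(* The last clause constrains inhabited sets only, because Zorn's lemma also asks for the union of
   the empty chain. *)
pose ok (S : set A) := [/\ forall x y, S x -> S y -> S (x * y), ~ S 0 &
  forall x, S x -> S 1 /\ S a].
have pow0 x n : x ^+ n = 0 -> x = 0 := red x n.
have [F Fok Ftot|S [[Sm S0 Sa] Smax]] := @Zorn_bigcup A ok.
  split=> [x y [U FU Ux] [V FV Vy]|[U FU]|x [U FU Ux]].
  - have [UV|VU] := Ftot _ _ FU FV.
      by exists V => //; have [m _ _] := Fok _ FV; apply: m => //; apply: UV.
    by exists U => //; have [m _ _] := Fok _ FU; apply: m => //; apply: VU.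
  - by have [_ nU _] := Fok _ FU.
  - by have [_ _ /(_ _ Ux) [U1 Ua]] := Fok _ FU; split; exists U.
(* The multiplicative set generated by [S] and [x]; the alternative [s = 1] serves the case of an
   empty [S]. *)
pose ext (x : A) : set A := fun y => exists s n, (S s \/ s = 1) /\ y = s * x ^+ n.
have Sext x : (S `<=` ext x)%classic.
  by move=> s Ss; exists s, 0%N; split; [left|rewrite expr0 mulr1].
have ext_ok x : ~ ext x 0 -> (forall y, ext x y -> ext x a) -> ok (ext x).
  move=> e0 ea; split=> // [_ _ [s [n [Ss ->]]] [t [m [St ->]]]|y /ea ?].
    exists (s * t), (n + m)%N; split; last by rewrite exprD; ring.
    by case: Ss St => [?|->] [?|->]; rewrite ?mulr1 ?mul1r; [left; apply: Sm|left|left|right].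
  by split=> //; exists 1, 0%N; split; [right|rewrite mulr1].
have ext_self x : ext x x by exists 1, 1%N; split; [right|rewrite mul1r].
have grow x : ok (ext x) -> S x.
  move=> okx; apply: contrapT => nSx; apply: (Smax (ext x)) => //.
  by split=> [|/(_ x (ext_self x))].
have [S1 Saa] : S 1 /\ S a.
  have [[x /Sa]|nS] := pselect (exists x, S x); first by [].
  apply: (Sa a); apply: grow; apply: ext_ok => [[s [n [[Ss|->]]]]|//].
    by case: nS; exists s.
  by rewrite mul1r => /esym /pow0 /eqP; rewrite (negPf a0).
(* By maximality [ext x] contains 0, so [s * x ^+ n = 0]; then [s * x] is nilpotent, hence 0. *)
have SP x : ~ S x -> exists2 s, S s & s * x = 0.
  move=> nSx; have [[s [n [Ss e]]]|n0] := pselect (ext x 0).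
    exists s; first by case: Ss => [//|->].
    apply: (@pow0 _ n.+1); rewrite exprMn exprSr (exprS x) mulrACA.
    by rewrite -e mulr0.
  case: nSx; apply: grow; apply: ext_ok => // y _; exact: Sext.
have [| | | |P PE] := @ex_prime_ideal (fun x => ~ S x).
- by [].
- by apply.
- move=> c u v /SP [s Ss su] /SP [t St tv] /(Sm _ _ (Sm _ _ Ss St)).
  rewrite (_ : _ * _ = t * c * (s * u) + s * (t * v)); last by ring.
  by rewrite su tv !mulr0 addr0.
- move=> u v nuv; apply: contrapT => /not_orP [/contrapT Su /contrapT Sv].
  by apply: nuv; apply: Sm.
exists P; last by apply/negP => /PE.
move=> P' sP x; apply/idP/idP => [/sP //|/PE /SP [s Ss sx]].
have : s * x \in P' by rewrite sx rpred0.
rewrite prime_idealrM => /orP [/sP /PE|] //.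
Qed.

Lemma reduced_min_covered : reduced_ring A -> finitely_many_minimal_primes A ->
  covered (fun=> True).
Proof.
move=> red [n [P PE]]; exists n, P => x _ xP; apply/eqP/negPn/negP => x0.
have [Q /PE [i QE]] := exists_minimal_prime red x0.
by rewrite QE xP.
Qed.

End Primes.

Lemma covered_prime_family (A : comNzRingType) (I : A -> Prop) n (S : 'I_n -> A -> Prop) :
  (forall i, [/\ S i 0, ~ S i 1,
    forall a u v, S i u -> S i v -> S i (a * u + v) &
    forall u v, S i (u * v) -> S i u \/ S i v]) ->
  (forall x, I x -> (forall i, S i x) -> x = 0) -> covered I.
Proof.
move=> Sp S0.
have /choice [P PE] i : exists P : prime_idealr A, forall x, x \in P <-> S i x.
  by have [? ? ? ?] := Sp i; apply: ex_prime_ideal.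
by exists n, P => x Ix xP; apply: S0 => // i; apply/PE.
Qed.

(** * Coverings under ring maps, polynomial extension and splitting *)

Section Covered.
Variable A : comNzRingType.

Lemma covered_contraction (B : comNzRingType) (phi : {rmorphism A -> B}) :
  injective phi -> covered (fun _ : B => True) -> covered (fun _ : A => True).
Proof.
move=> phi_inj [n [P P0]].
apply: (@covered_prime_family _ _ n (fun i x => phi x \in P i)) => [i|x _ xP].
  split=> [||a u v Pu Pv|u v].
  - by rewrite rmorph0 rpred0.
  - by rewrite rmorph1 idealr1.
  - by rewrite rmorphD rmorphM rpredD // idealMr.
  - by rewrite rmorphM prime_idealrM => /orP.
by apply: phi_inj; rewrite rmorph0; apply: P0.
Qed.

(** The element 1 lies in a finite sum of simple ideals. The annihilators in [A] of these summands
    are prime, and an element of all of them kills 1. *)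
Lemma semisimple_covered (B : comNzRingType) (phi : {rmorphism A -> B}) :
  injective phi -> semisimple_ring B -> covered (fun _ : A => True).
Proof.
move=> phi_inj [J [S [Ssimple [Sgen _]]]].
have [s [f fS e1]] := Sgen 1.
pose ann (i : 'I_(size s)) (x : A) :=
  forall y, y \in S (tnth (in_tuple s) i) -> phi x * y = 0.
apply: (@covered_prime_family _ _ _ ann) => [i|x _ xann].
  have [[z zS z0] Smin] := Ssimple (tnth (in_tuple s) i).
  split=> [y _||a u v hu hv y yS|u v huv].
  - by rewrite rmorph0 mul0r.
  - by move=> /(_ z zS) /eqP; rewrite rmorph1 mul1r (negPf z0).
  - by rewrite rmorphD rmorphM mulrDl -mulrA hu // hv // mulr0 addr0.
  have [|nv] := pselect (ann i v); [by right | left].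
  (* The multiple of the simple summand by [phi v] is either the whole summand, which [u] then
     kills, or 0, and then [v] kills the summand. *)
  pose K (y : B^o) := `[< exists2 w, w \in S (tnth (in_tuple s) i) & y = phi v * w >].
  have Klin : submod_closed (K : {pred B^o}).
    split; first by apply/asboolP; exists 0; rewrite ?rpred0 ?mulr0.
    move=> a _ _ /asboolP [w wS ->] /asboolP [t tS ->]; apply/asboolP.
    exists (a *: w + t); first by rewrite rpredD ?rpredZ.
    by rewrite mulrDr /GRing.scale /= mulrCA.
  pose Ks : submodClosed B^o :=
    HB.pack K (GRing.isSubmodClosed.Build B B^o K (GRing.submod_closed_semi Klin)).
  have [|SK|K0] := Smin Ks.
  - by move=> y /asboolP [w wS ->]; apply: (rpredZ (phi v) (wS)).
  - move=> y /SK /asboolP [w wS ->]; rewrite mulrA -rmorphM; exact: huv.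
  - case: nv => y yS; apply: (K0 (phi v * y)); apply/asboolP.
    by exists y.
apply: phi_inj; rewrite rmorph0 -[phi x]mulr1 e1 mulr_sumr big_tnth big1 // => i _.
exact: xann.
Qed.

(** The primes used are the extensions of the [P i], the polynomials with all coefficients in
    [P i]. *)
Lemma covered_poly : covered (fun _ : A => True) ->
  covered (fun _ : {poly A} => True).
Proof.
case=> n [P P0].
apply: (@covered_prime_family _ _ n (fun i (f : {poly A}) => forall k, f`_k \in P i)) => [i|f _ fP].
  split=> [k||a u v hu hv k|u v huv].
  - by rewrite coef0 rpred0.
  - by move/(_ 0%N); rewrite coef1 idealr1.
  - by rewrite coefD coefM rpredD // rpred_sum // => j _; rewrite idealMr.
  - apply: contrapT => /not_orP [/existsNP [k0 /negP nk] /existsNP [l0 /negP nl]].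
    have exk : exists k, u`_k \notin P i by exists k0.
    have exl : exists l, v`_l \notin P i by exists l0.
    (* For the least such [k] and [l], every term but one of the coefficient of degree [k + l] in
       [u * v] lies in [P i]. *)
    case: (ex_minnP exk) => k nuk kmin; case: (ex_minnP exl) => l nvl lmin.
    have := huv (k + l)%N; rewrite coefM (bigD1 (Ordinal (leq_addr l k : (k < (k + l).+1)%N))) //=.
    rewrite rpredDr ?addKn ?prime_idealrM ?(negPf nuk) ?(negPf nvl) //.
    apply: rpred_sum => j; rewrite -val_eqE /= => jk; rewrite prime_idealrM.
    case: (ltngtP j k) jk => // [jk|kj] _; apply/orP; [left|right].
      by apply: contraLR jk => /kmin; rewrite -leqNgt.
    apply/negPn/negP => /lmin; have := ltn_ord j; rewrite ltnS => jkl.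
    by rewrite leqNgt ltn_subLR // ltn_add2r kj.
apply/polyP => k; rewrite coef0; apply: P0 => // i; exact: fP.
Qed.

(** Let [x] in [I] lie in all the primes. Then [x * b] is killed by the annihilator of [b], so the
    [Q j] give [x * b = 0], and now the [P i] give [x = 0]. *)
Lemma covered_split (I : A -> Prop) (b : A) :
  (forall a x, I x -> I (a * x)) ->
  covered (fun x => I x /\ x * b = 0) ->
  covered (fun x => I x /\ forall y, y * b = 0 -> x * y = 0) -> covered I.
Proof.
move=> Imul [n [P P0]] [m [Q Q0]].
exists (n + m)%N, (fun k => match split k with inl i => P i | inr j => Q j end).
move=> x Ix xPQ.
have xP i : x \in P i by have := xPQ (unsplit (inl i)); rewrite unsplitK.
have xQ i : x \in Q i by have := xPQ (unsplit (inr i)); rewrite unsplitK.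
apply: P0 => //; split=> //; apply: Q0 => [|j]; last by rewrite mulrC idealMr ?xQ.
split=> [|y yb]; first by rewrite mulrC; apply: Imul.
by rewrite -mulrA (mulrC b) yb mulr0.
Qed.

(** If [I] contains nonzero [b] and [c] with [b * c = 0], one of the two pieces in [covered_split]
    is not covered. The first is killed by [b], the second by [c]. *)
Lemma not_covered_step (I : A -> Prop) : reduced_ring A ->
  (forall a x, I x -> I (a * x)) -> ~ covered I ->
  exists b (I' : A -> Prop), [/\ I b, b != 0, (forall a x, I' x -> I' (a * x)),
   ~ covered I' & forall x, I' x -> I x /\ x * b = 0].
Proof.
move=> red Imul nI.
have [[b [c [Ib Ic [b0 c0 bc]]]]|nbc] := pselect (exists b c, [/\ I b, I c &
    [/\ b != 0, c != 0 & b * c = 0]]).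
  have [cb|ncb] := pselect (covered (fun x => I x /\ x * b = 0)).
    exists c, (fun x => I x /\ forall y, y * b = 0 -> x * y = 0); split=> //.
    - move=> a x [Ix xb]; split; first exact: Imul.
      by move=> y /xb xy; rewrite -mulrA xy mulr0.
    - by move=> ?; apply: nI; apply: covered_split cb _.
    - by move=> x [Ix xb]; split=> //; apply: xb; rewrite mulrC.
  exists b, (fun x => I x /\ x * b = 0); split=> // a x [Ix xb]; split.
    exact: Imul.
  by rewrite -mulrA xb mulr0.
case: nI; have [[i Ii i0]|nI] := pselect (exists2 i, I i & i != 0); last first.
  apply: (@covered_prime_family _ _ 0 (fun _ _ => True)) => [[]//|x Ix _].
  by apply/eqP/negPn/negP => x0; apply: nI; exists x.
apply: (@covered_prime_family _ _ 1 (fun _ x => forall y, I y -> x * y = 0)) => [_|x Ix xI].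
  split=> [y|/(_ i Ii)|a u v hu hv y Iy|u v huv].
  - by rewrite mul0r.
  - by move/eqP; rewrite mul1r (negPf i0).
  - by rewrite mulrDl -mulrA hu // hv // mulr0 addr0.
  have [|nu] := pselect (forall y, I y -> u * y = 0); [by left | right => y Iy].
  apply: contrapT => /eqP vy0; apply: nu => z Iz; apply: contrapT => /eqP uz0.
  apply: nbc; exists (u * z), (v * y); split; [exact: Imul|exact: Imul|split=> //].
  by rewrite mulrACA mulrA huv ?mul0r.
by apply: (red x 2); rewrite expr2; apply: (xI ord0).
Qed.

Lemma reduced_orthogonal_covered : reduced_ring A ->
  (forall b : nat -> A, (forall i j, i != j -> b i * b j = 0) -> exists i, b i = 0) ->
  covered (fun _ : A => True).
Proof.
move=> red orth; apply: contrapT => nA.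
(* Packing the invariants into a type lets choice produce a step function that can be iterated. Each
   [b j] then lies in a set killed by all earlier [b i]. *)
pose T := {I : A -> Prop | (forall a x, I x -> I (a * x)) /\ ~ covered I}.
have /choice [g gP] (I : T) : exists bI : A * T, [/\ sval I bI.1, bI.1 != 0 &
    forall x, sval bI.2 x -> sval I x /\ x * bI.1 = 0].
  have [Imul nI] := svalP I.
  have [b [I' [Ib b0 I'mul nI' I'P]]] := not_covered_step red Imul nI.
  by exists (b, exist _ I' (conj I'mul nI')).
pose T0 : T := exist _ (fun _ => True) (conj (fun _ _ _ => Logic.I) nA).
pose St n := iter n (fun I => (g I).2) T0; pose b n := (g (St n)).1.
have StS n : St n.+1 = (g (St n)).2 by [].
have sub n k x : sval (St (n + k)%N) x -> sval (St n) x.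
  elim: k => [|k IH]; first by rewrite addn0.
  by rewrite addnS StS; have [_ _ h] := gP (St (n + k)%N) => /h [/IH].
have bb i j : (i < j)%N -> b j * b i = 0.
  move=> ij; have [bj _ _] := gP (St j).
  have [_ _ h] := gP (St i).
  have : sval (St i.+1) (b j) by apply: (sub _ (j - i.+1)%N); rewrite subnKC.
  by rewrite StS => /h [].
have [i j /= ij|i bi0] := orth b.
  by have [/bb|/bb|/eqP] := ltngtP i j; rewrite ?(negPf ij) // mulrC.
by have [_] := gP (St i); rewrite -/(b i) bi0 eqxx.
Qed.

End Covered.

(** * Semisimple overrings *)

Lemma ex_submod (R : pzRingType) (V : lmodType R) (S : V -> Prop) : S 0 ->
  (forall a u v, S u -> S v -> S (a *: u + v)) ->
  exists K : submodClosed V, forall x, x \in K <-> S x.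
Proof.
move=> S0 Slin; pose Sb (x : V) := `[< S x >].
have Sl : submod_closed (Sb : {pred V}).
  split=> [|a u v /asboolP Su /asboolP Sv]; apply/asboolP; [exact: S0|exact: Slin].
pose K : submodClosed V :=
  HB.pack Sb (GRing.isSubmodClosed.Build R V Sb (GRing.submod_closed_semi Sl)).
by exists K => x; split=> /asboolP.
Qed.

Lemma ideal_mul (R : comNzRingType) (I : submodClosed R^o) (a x : R) :
  x \in I -> a * x \in I.
Proof. exact: (@rpredZ _ _ I a x). Qed.

Lemma ideal_lin (R : comNzRingType) (I : submodClosed R^o) (a x y : R) :
  x \in I -> y \in I -> a * x + y \in I.
Proof. by move=> xI yI; apply: (@rpredD _ I (a * x) y) => //; apply: ideal_mul. Qed.

Section Orthogonal.
Variable A : comNzRingType.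

Lemma covered_separated : covered (fun _ : A => True) ->
  exists (n : nat) (P : 'I_n -> prime_idealr A) (x : 'I_n -> A),
  [/\ forall y, (forall i, y \in P i) -> y = 0,
      forall i j, i != j -> x i \in P j & forall i, x i \notin P i].
Proof.
pose good n := exists P : 'I_n -> prime_idealr A,
  forall y, (forall i, y \in P i) -> y = 0.
case=> n0 [P1 P10].
have exn : exists n, `[< good n >].
  by exists n0; apply/asboolP; exists P1 => y; apply: P10.
case: (ex_minnP exn) => n /asboolP [P P0] nmin.
suff /choice [x xP] i : exists x, (forall j, i != j -> x \in P j) /\ x \notin P i.
  by exists n, P, x; split=> // [i j|i]; [case: (xP i) => + _; apply|case: (xP i)].
case: n P P0 nmin i => [|n] P P0 nmin i; first by case: i.
apply: contrapT => nx; suff /asboolP/nmin : good n by rewrite ltnn.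
exists (fun j => P (fintype.lift i j)) => y yP; apply: P0.
have yPj j : i != j -> y \in P j by move=> /unlift_some [k -> _]; apply: yP.
move=> j; have [<-|/yPj //] := eqVneq i j.
by apply/negPn/negP => yi; apply: nx; exists y.
Qed.

Lemma covered_regular n (P : 'I_n -> prime_idealr A) (s : A) :
  (forall y, (forall i, y \in P i) -> y = 0) -> (forall i, s \notin P i) ->
  GRing.lreg s.
Proof.
move=> P0 sP u v /eqP; rewrite -subr_eq0 -mulrBr => /eqP suv.
apply/eqP; rewrite -subr_eq0; apply/eqP/P0 => i.
have : s * (u - v) \in P i by rewrite suv rpred0.
by rewrite prime_idealrM (negPf (sP i)).
Qed.

Lemma notin_prime_sum n (P : prime_idealr A) (y : 'I_n -> A) i :
  (forall j, j != i -> y j \in P) -> y i \notin P -> \sum_j y j \notin P.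
Proof. by move=> yP yi; rewrite (bigD1 i) //= rpredDr // rpred_sum. Qed.

End Orthogonal.

Section IdempotentDecomposition.
Variables (B : comNzRingType) (n : nat) (e : 'I_n -> B).
Hypothesis e_orth : forall i j, i != j -> e i * e j = 0.
Hypothesis e_sum : \sum_i e i = 1.
Hypothesis e_neq0 : forall i, e i != 0.
Hypothesis e_field : forall i a, e i * a != 0 -> exists b, e i * a * b = e i.

(** By [e_field] each ideal generated by [e i] is a field, hence simple; these ideals are the
    summands, described as the fixed points of [e i]. *)
Lemma idempotents_semisimple : semisimple_ring B.
Proof.
have e_idem i : e i * e i = e i.
  rewrite -[RHS]mulr1 -e_sum mulr_sumr (bigD1 i) //= big1 ?addr0 // => j ji.
  by rewrite e_orth // eq_sym.
have /choice [S SE] i : exists K : submodClosed B^o, forall x : B, x \in K <-> e i * x = x.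
  apply: ex_submod => [|a u v eu ev]; first by rewrite mulr0.
  by rewrite mulrDr mulrCA eu ev.
exists ('I_n : choiceType), S; split=> [i|].
  split; first by exists (e i) => //; apply/SE.
  move=> K KS; have [[x xK x0]|nK] := pselect (exists2 x, x \in K & x != 0).
    left=> y /SE <-; have ex : e i * x = x by apply/SE/KS.
    have [|b eb] := @e_field i x; first by rewrite ex.
    by rewrite -{1}eb ex -mulrA mulrC; apply: ideal_mul.
  by right=> x xK; apply/eqP/negPn/negP => x0; apply: nK; exists x.
split=> [x|s f s_uniq fS fs0 i si].
  exists (enum 'I_n), (fun i => e i * x) => [i|].
    by apply/SE; rewrite mulrA e_idem.
  by rewrite big_enum -mulr_suml e_sum mul1r.
have : e i * (\sum_(j <- s) f j) = 0 by rewrite fs0 mulr0.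
rewrite (bigD1_seq i) //= mulrDr mulr_sumr big1 => [|j ji].
  by rewrite addr0 => <-; symmetry; apply/SE.
have /SE <- := fS j; by rewrite mulrA e_orth ?mul0r // eq_sym.
Qed.

End IdempotentDecomposition.

(** The last condition on [phi] makes [B] an essential extension of [A]. This form suits finite
    fractions too, which come with a denominator ideal instead of one regular denominator. *)
Lemma covered_semisimple (A B : comNzRingType) (phi : {rmorphism A -> B}) :
  injective phi ->
  (forall s, GRing.lreg s -> exists t, phi s * t = 1) ->
  (forall u, u != 0 -> exists r b, phi r * u = phi b /\ phi b != 0) ->
  covered (fun _ : A => True) -> semisimple_ring B.
Proof.
move=> phi_inj phi_unit phi_ess /covered_separated [n [P [x [P0 xP xnP]]]].
have xi0 y i : (forall j, j != i -> y \in P j) -> y \in P i -> y = 0.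
  by move=> yP yi; apply: P0 => j; have [->|/yP] := eqVneq j i.
have xx0 i j : i != j -> x i * x j = 0.
  move=> ij; apply: P0 => k; rewrite prime_idealrM.
  have [<-|ik] := eqVneq i k; last by rewrite (xP _ _ ik).
  by rewrite (xP j i) ?orbT // eq_sym.
have [|t st] := phi_unit (\sum_i x i).
  apply: covered_regular P0 _ => i; apply: notin_prime_sum (xnP i) => j.
  exact: xP.
pose e i := phi (x i) * t.
have e_orth i j : i != j -> e i * e j = 0.
  by move=> ij; rewrite mulrACA -rmorphM xx0 // rmorph0 mul0r.
(* Of the sum inverse to [t], only the term [x i] survives multiplication by such an [a]. *)
have e_phi i a : (forall j, j != i -> a \in P j) -> e i * phi a = phi a.
  move=> aP; rewrite -[RHS]mulr1 -st mulrA -rmorphM mulrAC -rmorphM.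
  congr (phi _ * _); rewrite mulrC mulr_sumr (bigD1 i) //= big1 ?addr0 // => j ji.
  apply: (xi0 _ i) => [k ki|]; first by rewrite prime_idealrM aP.
  by rewrite prime_idealrM (xP j i) ?orbT.
have e_neq0 i : e i != 0.
  apply/eqP => e0; have := e_phi i (x i); rewrite e0 mul0r => h.
  have : x i \notin P i by []; rewrite (_ : x i = 0) ?rpred0 //.
  by apply: phi_inj; rewrite -h ?rmorph0 // => j ji; rewrite xP // eq_sym.
apply: (@idempotents_semisimple B n e) => //; first by rewrite -mulr_suml -rmorph_sum.
move=> i a /phi_ess [r [b [rb b0]]].
have ei_idem : e i * e i = e i.
  by rewrite /e mulrA (e_phi i) // => j ji; rewrite xP // eq_sym.
have eb : e i * phi b = phi b by rewrite -rb mulrCA (mulrA (e i)) ei_idem.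
have bP j : j != i -> b \in P j.
  move=> ji; have : phi (x j) * phi b = 0.
    by rewrite -eb /e mulrA mulrA -rmorphM xx0 // rmorph0 !mul0r.
  rewrite -rmorphM -(rmorph0 phi) => /phi_inj xb.
  have : x j * b \in P j by rewrite xb rpred0.
  by rewrite prime_idealrM (negPf (xnP j)).
have biP : b \notin P i.
  by apply: contra b0 => bi; rewrite (xi0 b i bP bi) rmorph0.
(* Inserting [b] into the term of index [i] keeps the sum outside every prime. Its inverse [w] then
   inverts [phi (x i * b)] on the component of [e i], and [phi b] is a multiple of [e i * a]. *)
pose y j := if j == i then x i * b else x j.
have [|w uw] := phi_unit (\sum_j y j).
  apply: covered_regular P0 _ => k; apply: (notin_prime_sum (i := k)).
    by move=> j /(xP j) xjk; rewrite /y; case: eqP xjk => [->|//] xik; rewrite prime_idealrM xik.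
  by rewrite /y; case: eqP => [->|//]; rewrite prime_idealrM negb_or xnP.
exists (phi r * phi (x i) * w).
have -> : e i * a * (phi r * phi (x i) * w) = phi r * (e i * a) * phi (x i) * w by ring.
rewrite rb -[phi b]eb.
transitivity (e i * (phi (x i * b) * w)); first by rewrite rmorphM; ring.
rewrite -[RHS]mulr1 -uw mulrA [RHS]mulrA; congr (_ * w).
rewrite rmorph_sum mulr_sumr (bigD1 i) //= big1 /y ?eqxx ?addr0 // => j ji.
by rewrite (negPf ji) /e mulrAC -rmorphM xx0 ?rmorph0 ?mul0r // eq_sym.
Qed.

Lemma polyC_lreg (R : comNzRingType) (s : R) : GRing.lreg s -> GRing.lreg s%:P.
Proof.
move=> sreg f g /polyP fg; apply/polyP => k; apply: sreg.
by have := fg k; rewrite !coefCM.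
Qed.

(** * The total ring of quotients *)

Section TotalQuotTheory.
Variable A : comNzRingType.

Lemma emb_inj : injective (@to_total_quot A).
Proof. by move=> a b /TotalQuot.pi_eqP /=; rewrite !mulr1 => /eqP. Qed.

Lemma emb_unit (s : A) : GRing.lreg s -> exists t, to_total_quot s * t = 1.
Proof.
move=> sreg; exists (\pi_(total_quot A) (TotalQuot.mk_ratio 1 sreg)).
rewrite /GRing.mul /= /to_total_quot TotalQuot.pi_mul; apply/TotalQuot.pi_eqP => /=.
by rewrite !mulr1 !mul1r.
Qed.

Lemma total_quotP (u : total_quot A) :
  exists a s, GRing.lreg s /\ to_total_quot s * u = to_total_quot a.
Proof.
elim/quotW: u => x; exists (TotalQuot.frac x).1, (TotalQuot.frac x).2; split; first exact: TotalQuot.denomP.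
rewrite /GRing.mul /= /to_total_quot TotalQuot.pi_mul; apply/TotalQuot.pi_eqP => /=.
by rewrite mulr1 mul1r mulrC.
Qed.

Lemma emb_reg (s : A) (u : total_quot A) :
  GRing.lreg s -> to_total_quot s * u = 0 -> u = 0.
Proof.
by move=> /emb_unit [t st] su; rewrite -[u]mul1r -st mulrAC su mul0r.
Qed.

Lemma total_quot_semisimple :
  covered (fun _ : A => True) -> semisimple_ring (total_quot A).
Proof.
apply: (@covered_semisimple A _ (@to_total_quot A)) => [||u u0]; [exact: emb_inj|exact: emb_unit|].
have [a [s [sreg su]]] := total_quotP u; exists s, a; split=> //.
by apply: contra u0 => /eqP a0; apply/eqP/(emb_reg sreg); rewrite su.
Qed.

End TotalQuotTheory.

(** * McCoy's theorem on regular polynomials *)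

Section McCoy.
Variable R : comNzRingType.

(** Once every coefficient of [g] kills [h], the leading coefficient of [h] is 0 by hypothesis. The
    induction is on the size of [h]. *)
Lemma mccoy (g : {poly R}) :
  (forall r : R, (forall k, g`_k * r = 0) -> r = 0) -> GRing.lreg g.
Proof.
move=> gdense; suff g0 h : g * h = 0 -> h = 0.
  move=> u v /eqP; rewrite -subr_eq0 -mulrBr => /eqP /g0 /eqP.
  by rewrite subr_eq0 => /eqP.
have [n] := ubnP (size h); elim: n h => // n IH h hn gh.
have [//|h0] := eqVneq h 0.
have gk k : g`_k *: h = 0.
  (* Descending induction on [k]. If the higher coefficients of [g] kill [h], the coefficient of
     degree [k + (size h).-1] in [g * h] shows that this one kills the leading coefficient of [h].
     The scaled [h] is therefore shorter, and [IH] applies to it. *)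
  have [m] := ubnP (size g - k); elim: m k => // m IHm k km.
  have [kg|kg] := leqP (size g) k; first by rewrite nth_default ?scale0r.
  have hi l : (k < l)%N -> g`_l *: h = 0.
    move=> kl; apply: IHm; apply: leq_trans (_ : size g - k <= m)%N => //.
    by apply: ltn_sub2l.
  apply: IH; last by rewrite -scalerAr gh scaler0.
  rewrite ltnS in hn; apply: leq_trans hn.
  have hs : (0 < size h)%N by rewrite size_poly_gt0.
  rewrite -(prednK hs) ltnS.
  apply/leq_sizeP => j; rewrite leq_eqVlt => /orP [/eqP <-|jh]; last first.
    by rewrite coefZ (nth_default _ (_ : (size h <= j)%N)) ?mulr0 // -(prednK hs).
  have := congr1 (fun f : {poly R} => f`_(k + (size h).-1)%N) gh.
  rewrite coefM coef0 (bigD1 (Ordinal (leq_addr (size h).-1 k : (k < (k + (size h).-1).+1)%N))) //=.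
  rewrite addKn big1 ?addr0 ?coefZ // => -[l /= lk] /=; rewrite -val_eqE /= => nkl.
  have [lk'|kl|lk'] := ltngtP l k; last by rewrite lk' eqxx in nkl.
    rewrite (nth_default _ (_ : (size h <= _)%N)) ?mulr0 //.
    by rewrite leq_subRL // -{1}(prednK hs) addnS ltn_add2r.
  by have /polyP/(_ (k + (size h).-1 - l)%N) := hi l kl; rewrite coefZ coef0.
apply/eqP; rewrite -lead_coef_eq0; apply/eqP/gdense => k.
by have /polyP/(_ (size h).-1) := gk k; rewrite coefZ coef0.
Qed.

End McCoy.

(** * The ring of finite fractions *)

Section FiniteFractionsTheory.
Variable R : comNzRingType.

(** The ideal kills every coefficient of a numerator of [u], and it is dense. *)
Lemma in_Q_torsionfree I (u : total_quot {poly R}) : in_Q I ->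
  (forall r, r \in I -> to_total_quot r%:P * u = 0) -> u = 0.
Proof.
move=> QI Iu; have [f [g [greg gu]]] := total_quotP u.
apply: (emb_reg greg); rewrite gu (_ : f = 0) ?rmorph0 //.
apply/polyP => k; rewrite coef0; apply: (in_Q_dense QI) => r rI.
rewrite -coefCM (_ : r%:P * f = 0) ?coef0 //; apply: emb_inj.
by rewrite rmorphM -[X in _ * X]gu mulrCA Iu // mulr0 rmorph0.
Qed.

Lemma in_Q_principal (s : R) : GRing.lreg s ->
  exists2 I : submodClosed R^o, in_Q I & forall x, x \in I <-> exists c, x = c * s.
Proof.
move=> sreg.
have [||I IE] := @ex_submod R R^o (fun x => exists c, x = c * s).
- by exists 0; rewrite mul0r.
- by move=> a _ _ [c ->] [d ->]; exists (a * c + d); rewrite mulrDl -mulrA.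
exists I => //; have fI : finitely_generated I.
  exists 1%N, (fun _ => s) => x; rewrite IE; split=> [[c ->]|[c ->]].
    by exists (fun _ => c); rewrite big_ord1.
  by exists (c ord0); rewrite big_ord1.
split=> //; exists I; split=> // r Ir; apply: sreg; rewrite mulr0.
by apply: Ir; apply/IE; exists 1; rewrite mul1r.
Qed.

Lemma finite_fraction_of (s : R) (u : total_quot {poly R}) (b : R) :
  GRing.lreg s -> to_total_quot s%:P * u = to_total_quot b%:P -> u \in @Q0_pred R.
Proof.
move=> /in_Q_principal [I QI IE] su; apply/asboolP; exists I => // r /IE [c ->].
by exists (c * b); rewrite !polyCM !rmorphM -mulrA /= su.
Qed.

Fact Q0_emb_subproof (r : R) : to_total_quot r%:P \in @Q0_pred R.
Proof. by apply: (@finite_fraction_of 1 _ r); [exact: lreg1|rewrite mul1r]. Qed.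

Definition Q0_emb (r : R) : finite_fractions R := FiniteFraction (Q0_emb_subproof r).

Fact Q0_emb_additive : zmod_morphism Q0_emb.
Proof. by move=> a b; apply: val_inj; rewrite /= polyCB rmorphB. Qed.

Fact Q0_emb_multiplicative : monoid_morphism Q0_emb.
Proof. by split=> [|a b]; apply: val_inj; rewrite /= ?polyCM ?rmorphM. Qed.

HB.instance Definition _ :=
  GRing.isZmodMorphism.Build R (finite_fractions R) Q0_emb Q0_emb_additive.
HB.instance Definition _ :=
  GRing.isMonoidMorphism.Build R (finite_fractions R) Q0_emb Q0_emb_multiplicative.

Lemma Q0_emb_inj : injective Q0_emb.
Proof. by move=> a b /(congr1 val) /= /emb_inj /polyC_inj. Qed.

Lemma finite_fractions_semisimple :
  covered (fun _ : R => True) -> semisimple_ring (finite_fractions R).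
Proof.
apply: (@covered_semisimple R _ Q0_emb) => [|s sreg|u u0].
- exact: Q0_emb_inj.
- have [t st] := emb_unit (polyC_lreg sreg).
  have tQ : t \in @Q0_pred R by apply: (finite_fraction_of sreg (b := 1)); rewrite st.
  by exists (FiniteFraction tQ); apply: val_inj.
(* The denominator ideal cannot kill a nonzero [u], so some [r] in it gives a nonzero multiple of
   [u] lying in [R]. *)
- case: u u0 => u uQ u0; have /asboolP [I QI Iu] := uQ.
  have [[r rI ru]|nr] := pselect (exists2 r, r \in I & to_total_quot r%:P * u != 0).
    have [b rb] := Iu r rI; exists r, b; have e : Q0_emb r * FiniteFraction uQ = Q0_emb b.
      exact: val_inj.
    split; first exact: e.
    apply: contra ru => /eqP b0; rewrite rb (_ : b = 0) ?rmorph0 //.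
    by apply: Q0_emb_inj; rewrite b0 rmorph0.
  case/eqP: u0; apply: val_inj => /=; apply: in_Q_torsionfree QI _ => r rI.
  by apply/eqP/negPn/negP => ru; apply: nr; exists r.
Qed.

End FiniteFractionsTheory.

(** * Free resolutions and first Ext groups *)

Section Submodule.
Variables (R : pzRingType) (V : lmodType R) (S : submodClosed V).

Record submod := Submod { submod_val :> V; _ : submod_val \in S }.

HB.instance Definition _ := [isSub for submod_val].
HB.instance Definition _ := [Choice of submod by <:].
HB.instance Definition _ := [SubChoice_isSubLmodule of submod by <:].

End Submodule.

Section LinearMaps.
Variable R : pzRingType.
Implicit Types U V W P : lmodType R.

Lemma ex_linear U V (f : U -> V) :
  linear f -> exists g : {linear U -> V}, forall x, g x = f x.
Proof.
move=> flin.
pose g : {linear U -> V} := HB.pack f (GRing.isLinear.Build R U V *:%R f flin).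
by exists g.
Qed.

Lemma choice_linear U V (r : U -> V -> Prop) :
  (forall x, exists y, r x y) -> (forall x y y', r x y -> r x y' -> y = y') ->
  (forall a x x' y y', r x y -> r x' y' -> r (a *: x + x') (a *: y + y')) ->
  exists g : {linear U -> V}, forall x, r x (g x).
Proof.
move=> /choice [f fr] runiq rlin.
have [|g gf] := @ex_linear U V f; last by exists g => x; rewrite gf.
by move=> a x x'; apply: (runiq (a *: x + x')) => //; apply: rlin.
Qed.

Lemma ker_lin_eq U V W (d : {linear U -> V}) (f : {linear U -> W}) x y :
  (forall z, d z = 0 -> f z = 0) -> d x = d y -> f x = f y.
Proof.
move=> kf dxy; apply/eqP; rewrite -subr_eq0 -linearB; apply/eqP/kf.
by rewrite linearB dxy subrr.
Qed.

(** Since [projective_mod] lifts along surjections only, both maps are first corestricted to the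
    image of [d]. *)
Lemma projective_lift P U V (d : {linear U -> V}) (f : {linear P -> V}) :
  projective_mod P -> (forall x, exists y, d y = f x) ->
  exists h : {linear P -> U}, forall x, d (h x) = f x.
Proof.
move=> Pproj fd.
have [||S SE] := @ex_submod R V (fun v => exists y, d y = v).
- by exists 0; rewrite linear0.
- by move=> a _ _ [y <-] [z <-]; exists (a *: y + z); rewrite linearP.
have dS y : d y \in S by apply/SE; exists y.
have fS x : f x \in S by apply/SE.
have [|d' d'E] := @ex_linear U (submod S) (fun y => Submod (dS y)).
  by move=> a x y; apply: val_inj; rewrite /= linearP.
have [|f' f'E] := @ex_linear P (submod S) (fun y => Submod (fS y)).
  by move=> a x y; apply: val_inj; rewrite /= linearP.
have [v|h hE] := Pproj _ _ d' f'.
  by have /SE [y dy] := valP v; exists y; apply: val_inj; rewrite d'E.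
by exists h => x; have := congr1 val (hE x); rewrite d'E f'E.
Qed.

End LinearMaps.

Section FreeModule.
Variables (R : comNzRingType) (K : choiceType).

Lemma free_lift (M : lmodType R) (c : K -> M) :
  exists f : {linear {freeg K / R} -> M}, forall x, f << x >> = c x.
Proof.
pose L : {additive {freeg K / R} -> M} := HB.pack (fglift c)
  (GRing.isZmodMorphism.Build _ _ (fglift c) (lift_is_additive c)).
have LU k x : L << k *g x >> = k *: c x by exact: liftU.
have [|f fE] := @ex_linear R {freeg K / R} M L.
  move=> a u v; rewrite raddfD; congr (_ + _).
  rewrite -[in RHS](freeg_sumE u).
  have -> : a *: u = \sum_(x <- dom u) << a * coeff x u *g x >> by [].
  rewrite (raddf_sum L) (raddf_sum L) scaler_sumr.
  by apply: eq_bigr => x _; rewrite !LU scalerA.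
by exists f => x; rewrite fE LU scale1r.
Qed.

Lemma free_ext (M : lmodType R) (f g : {linear {freeg K / R} -> M}) :
  (forall x, f << x >> = g << x >>) -> forall u, f u = g u.
Proof.
move=> fg u; rewrite -(freeg_sumE u) !linear_sum; apply: eq_bigr => x _.
have -> : << coeff x u *g x >> = coeff x u *: << x >> :> {freeg K / R}.
  by apply/eqP/freeg_eqP => y; rewrite coeffZ !coeffU mul1r.
by rewrite !linearZ fg.
Qed.

Lemma free_projective : projective_mod {freeg K / R}.
Proof.
move=> M N g f gsurj.
have /choice [c cE] (x : K) : exists y, g y = f << x >> by apply: gsurj.
have [h hE] := free_lift c; exists h => u.
have [|gh ghE] := @ex_linear R {freeg K / R} N (g \o h).
  by move=> a x y; rewrite /= !linearP.
by rewrite -[LHS]ghE; apply: free_ext => x; rewrite ghE /= hE cE.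
Qed.

End FreeModule.

Section FreeResolution.
Variable R : comNzRingType.

(** A bundled linear map, the state of the recursion that builds a resolution: each step covers the
    kernel of the current map. *)
Record presentation := Presentation {
  pres_dom : lmodType R;
  pres_cod : lmodType R;
  pres_map : {linear pres_dom -> pres_cod}
}.

Lemma free_cover (V : lmodType R) (S : V -> Prop) : S 0 ->
  (forall a u v, S u -> S v -> S (a *: u + v)) ->
  exists (P : lmodType R) (f : {linear P -> V}), projective_mod P /\
    forall v, S v <-> exists x, f x = v.
Proof.
move=> S0 Slin; have [K KE] := ex_submod S0 Slin.
have [f fE] := free_lift (fun x : submod K => \val x).
exists {freeg (submod K) / R}, f; split; first exact: free_projective.
move=> v; split=> [/KE vK|[x <-]]; first by exists << Submod vK >>; rewrite fE.
apply/KE; rewrite -(freeg_sumE x) linear_sum rpred_sum // => k _.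
have -> : << coeff k x *g k >> = coeff k x *: << k >> :> {freeg (submod K) / R}.
  by apply/eqP/freeg_eqP => y; rewrite coeffZ !coeffU mul1r.
by rewrite linearZ rpredZ // fE; apply: valP.
Qed.

(** [Ext_vanishes] quantifies over all projective resolutions, so one is needed before it can be
    applied as a hypothesis. *)
Lemma projective_resolution (M : lmodType R) :
  exists X : resolution M, forall i, projective_mod (X i).
Proof.
have [|//|P0 [f0 [P0proj f0E]]] := @free_cover M (fun=> True); first by [].
have exst (p : presentation) : exists q : {P : lmodType R &
    {linear P -> pres_dom p}}, projective_mod (projT1 q) /\
    forall v, pres_map p v = 0 <-> exists x, projT2 q x = v.
  have [||P [f fP]] := @free_cover (pres_dom p) (fun v => pres_map p v = 0).
  - exact: linear0.
  - by move=> a u v u0 v0; rewrite linearP u0 v0 scaler0 addr0.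
  by exists (existT _ P f).
pose st p := projT1 (cid (exst p)).
have stP p : projective_mod (projT1 (st p)) /\
    forall v, pres_map p v = 0 <-> exists x, projT2 (st p) x = v.
  exact: projT2 (cid (exst p)).
pose next p := Presentation (projT2 (st p)).
pose X n := iter n next (Presentation f0).
have Xsurj : surjective_map (pres_map (X 0%N)) by move=> y; apply/f0E.
exists (@Resolution R M (fun n => pres_dom (X n)) (fun n => pres_map (X n.+1))
  (pres_map (X 0%N)) Xsurj (stP (X 0%N)).2 (fun n => (stP (X n.+1)).2)).
by case=> [|i] //=; have [] := stP (X i).
Qed.

End FreeResolution.

Section Ext1.
Variable R : comNzRingType.
Implicit Types (M N E : lmodType R) (I : submodClosed R^o).

(** A map on [I] is represented by a function on all of [R] that is linear on [I] only; [m] is the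
    value at 1 of its extension. *)
Definition extends_from I E := forall f : R -> E,
  (forall a, {in I &, forall x y, f (a * x + y) = a *: f x + f y}) ->
  exists m, {in I, forall x, f x = x *: m}.

(** Lifting the augmentation to [p] with values in [R] turns [f] into the cocycle [c]; a map [g]
    bounding it corrects [f] to a map on [R]. *)
Lemma Ext1_extends I E : Ext_vanishes 1 (cyclic_mod I) E -> extends_from I E.
Proof.
move=> ext f flin; have [X Xproj] := projective_resolution (cyclic_mod I).
have f0 : f 0 = 0.
  have := flin (-1) 0 0 (rpred0 _) (rpred0 _).
  by rewrite mulr0 addr0 scaleN1r addNr.
have fZ a x : x \in I -> f (a * x) = a *: f x.
  by move=> xI; have := flin a x 0 xI (rpred0 _); rewrite f0 !addr0.
have fD x y : x \in I -> y \in I -> f (x + y) = f x + f y.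
  by move=> xI yI; have := flin 1 x y xI yI; rewrite mul1r scale1r.
pose pi : {linear R^o -> cyclic_mod I} := @quotmod_proj R R^o I.
have pi0 x : pi x = 0 <-> x \in I.
  have -> : (pi x = 0) = (pi x = pi 0) by rewrite linear0.
  by split=> [/quotmod_eqP|xI]; [|apply/quotmod_eqP]; rewrite subr0.
have [|p pE] := projective_lift (d := pi) (f := res_aug X) (Xproj 0%N).
  by move=> x; exists (repr (res_aug X x)); apply: quotmod_projK.
have pd y : p (res_diff X 0 y) \in I.
  by apply/pi0; rewrite pE; apply/res_exact0; exists y.
have [|c cE] := @ex_linear R (X 1%N) E (fun y => f (p (res_diff X 0 y))).
  move=> a x y; rewrite 2!linearP /=; exact: flin.
have [|g gE] := ext X Xproj c.
  move=> y; rewrite cE (_ : res_diff X 0 _ = 0) ?linear0 ?f0 //.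
  by apply/res_exactS; exists y.
have [x1 x1E] := res_aug_surj X (pi 1).
have x1I : 1 - p x1 \in I by apply/pi0; rewrite linearB pE x1E subrr.
(* For [r] in [I] the element [r *: x1] is a boundary, where [g] agrees with [f] after [p]; so the
   terms with [p] cancel and [f r] remains. *)
exists (f (1 - p x1) + g x1) => r rI.
have /res_exact0 [y dy] : res_aug X (r *: x1) = 0.
  rewrite linearZ x1E -linearZ; apply/pi0.
  by rewrite /GRing.scale /= mulr1.
rewrite scalerDr -fZ // -linearZ -dy -gE cE dy -fD ?linearZ.
- by rewrite -scalerDr subrK /GRing.scale /= mulr1.
- by rewrite rpredZ.
- by rewrite -linearZ -dy.
Qed.

(** A cocycle on [X 1] factors through the image of [X 1] in [X 0], from which injectivity extends
    it. *)
Lemma injective_Ext1 M E : injective_mod E -> Ext_vanishes 1 M E.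
Proof.
move=> Einj X Xproj f fd.
have [||S SE] := @ex_submod R (X 0%N) (fun v => exists y, res_diff X 0 y = v).
- by exists 0; rewrite linear0.
- by move=> a _ _ [y <-] [z <-]; exists (a *: y + z); rewrite linearP.
have fd0 z : res_diff X 0 z = 0 -> f z = 0 by move=> /res_exactS [w <-].
have [x|x y y'|a x x' y y'|f' f'E] := @choice_linear R (submod S) E
   (fun v e => exists y, res_diff X 0 y = \val v /\ e = f y).
- by have /SE [y dy] := valP x; exists (f y), y.
- by move=> [z [dz ->]] [z' [dz' ->]]; apply: (ker_lin_eq fd0); rewrite dz.
- move=> [z [dz ->]] [z' [dz' ->]]; exists (a *: z + z').
  by rewrite !linearP dz dz'.
have [h hE] := Einj _ _ (\val : {linear submod S -> X 0%N}) f' val_inj.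
exists h => y; have dS : res_diff X 0 y \in S by apply/SE; exists y.
rewrite -[res_diff X 0 y]/(\val (Submod dS)) hE.
by have [z [dz ->]] := f'E (Submod dS); apply: (ker_lin_eq fd0); rewrite dz.
Qed.

Lemma injective_extends I E : injective_mod E -> extends_from I E.
Proof. by move=> /injective_Ext1 Einj; apply: Ext1_extends. Qed.

End Ext1.

(** * Injectivity *)

Section Baer.
Variables (R : comNzRingType) (E : lmodType R).

Lemma baer_criterion : (forall I : submodClosed R^o, extends_from I E) -> injective_mod E.
Proof.
move=> Eext M N i f i_inj.
pose base : set (N * E) := fun u => exists x, u = (i x, f x).
(* These are graphs of partial linear maps extending [f]. The inclusion of [base] is again
   conditional because of the empty chain. *)
pose ok (G : set (N * E)) := [/\ forall a u v, G u -> G v -> G (a *: u.1 + v.1, a *: u.2 + v.2),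
  forall e, G (0, e) -> e = 0 & forall u, G u -> (base `<=` G)%classic].
have base_ok : ok base.
  split=> // [a _ _ [x ->] [y ->]|e [x [x0 ->]]|u _ w //].
    by exists (a *: x + y); rewrite !linearP.
  by rewrite (_ : x = 0) ?linear0 //; apply: i_inj; rewrite linear0.
have [F Fok Ftot|G [[Glin Gfun Gbase'] Gmax]] := @Zorn_bigcup (N * E)%type ok.
  split=> [a u v [U FU Uu] [V FV Vv]|e [U FU U0]|u [U FU Uu] w bw].
  - have [UV|VU] := Ftot _ _ FU FV.
      by exists V => //; have [l _ _] := Fok _ FV; apply: l => //; apply: UV.
    by exists U => //; have [l _ _] := Fok _ FU; apply: l => //; apply: VU.
  - by have [_ h _] := Fok _ FU; apply: h.
  - by exists U => //; have [_ _ h] := Fok _ FU; apply: (h u Uu).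
have Gbase : (base `<=` G)%classic.
  have [[u Gu]|nG] := pselect (exists u, G u); first exact: (Gbase' u Gu).
  case: (Gmax base _ base_ok); split=> [u Gu|bG]; first by case: nG; exists u.
  by apply: nG; exists (i 0, f 0); apply: bG; exists 0.
have G0 : G (0, 0) by apply: Gbase; exists 0; rewrite !linear0.
have Guniq x e e' : G (x, e) -> G (x, e') -> e = e'.
  move=> Ge Ge'; apply/eqP; rewrite -subr_eq0; apply/eqP/Gfun.
  by have := Glin (-1) _ _ Ge' Ge; rewrite /= !scaleN1r addNr addrC.
have Gtot y : exists e, G (y, e).
  (* The ideal of multipliers taking [y] into the domain of [G]. The extension [m] of the induced
     map on it becomes the value at [y], which enlarges [G] to [G']. *)
  have [||I IE] := @ex_submod R R^o (fun r => exists e, G (r *: y, e)).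
  - by exists 0; rewrite scale0r.
  - move=> a u v [e Ge] [e' Ge']; exists (a *: e + e').
    by rewrite scalerDl -scalerA; apply: Glin Ge Ge'.
  have /choice [g gP] (r : R) : exists e, r \in I -> G (r *: y, e).
    have [/IE [e Ge]|nI] := pselect (is_true (r \in I)); first by exists e.
    by exists 0.
  have [|m mE] := Eext I g.
    move=> a r s rI sI; apply: (Guniq ((a * r + s) *: y)).
      by apply: gP; apply: ideal_lin.
    by rewrite scalerDl -scalerA; apply: Glin (gP _ rI) (gP _ sI).
  pose G' : set (N * E) := fun u =>
    exists x e r, G (x, e) /\ u = (x + r *: y, e + r *: m).
  have GG' : (G `<=` G')%classic.
    by move=> [x e] Gxe; exists x, e, 0; rewrite !scale0r !addr0.
  suff G'G : (G' `<=` G)%classic.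
    by exists m; apply: G'G; exists 0, 0, 1; rewrite !scale1r !add0r.
  apply: contrapT => nG'G; apply: (Gmax G'); first by split.
  split=> [a _ _ [x [e [r [Gx ->]]]] [x' [e' [r' [Gx' ->]]]]|e|u _ w /Gbase /GG' //].
    exists (a *: x + x'), (a *: e + e'), (a * r + r'); split; first exact: Glin Gx Gx'.
    by rewrite /= !scalerDr !scalerDl !scalerA; congr pair; rewrite addrACA.
  move=> [x [e' [r [Gx [xr ->]]]]].
  have Gr : G (r *: y, - e').
    have := Glin (-1) _ _ Gx G0; rewrite /= !scaleN1r !addr0.
    by rewrite (_ : - x = r *: y) //; apply/esym/eqP; rewrite -addr_eq0 addrC -xr.
  have rI : r \in I by apply/IE; exists (- e').
  by rewrite -mE // (Guniq _ _ _ (gP r rI) Gr) subrr.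
have [//|//|a x x' y y' Gx Gx'|h hG] := @choice_linear R N E (fun x e => G (x, e)).
- exact: Glin Gx Gx'.
by exists h => x; apply: Guniq (hG _) _; apply: Gbase; exists x.
Qed.

End Baer.

Section CoveredInjective.
Variables (R : comNzRingType) (E : lmodType R).

Lemma covered_injective : covered (fun _ : R => True) ->
  (forall I, regular_ideal I -> extends_from I E) -> injective_mod E.
Proof.
move=> /covered_separated [n [P [x [P0 xP xnP]]]] Eext; apply: baer_criterion => I f flin.
pose annI (c : R) := forall u, u \in I -> c * u = 0.
have disj u : u \in I -> annI u -> u = 0.
  move=> uI /(_ u uI) uu; apply: P0 => i.
  have : u * u \in P i by rewrite uu rpred0.
  by rewrite prime_idealrM orbb.
have [||J JE] := @ex_submod R R^o (fun w => exists u c, [/\ u \in I, annI c & w = u + c]).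
- by exists 0, 0; split; rewrite ?rpred0 ?addr0 // => u _; rewrite mul0r.
- move=> a _ _ [u [c [uI ca ->]]] [u' [c' [uI' ca' ->]]].
  exists (a *: u + u'), (a * c + c'); split; first by rewrite rpredD ?rpredZ.
    by move=> v vI; rewrite mulrDl -mulrA ca // ca' // mulr0 addr0.
  by rewrite /GRing.scale /= mulrDr addrACA.
have IJ u : u \in I -> u \in J.
  by move=> uI; apply/JE; exists u, 0; split; rewrite ?addr0 // => v _; rewrite mul0r.
have annJ c : annI c -> c \in J.
  by move=> ca; apply/JE; exists 0, c; split; rewrite ?rpred0 ?add0r.
have uniq u c u' c' : u \in I -> u' \in I -> annI c -> annI c' -> u + c = u' + c' -> u = u'.
  move=> uI uI' ca ca' e; apply/eqP; rewrite -subr_eq0; apply/eqP/disj.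
    by rewrite -(scaleN1r (u' : R^o)) rpredD ?rpredZ.
  have -> : u - u' = c' - c by apply/eqP; rewrite subr_eq addrAC eq_sym subr_eq addrC -e addrC.
  by move=> v vI; rewrite mulrBl ca // ca' // subrr.
(* The extension of [f] to [J] by 0 on the annihilator of [I]. *)
have /choice [g gE] w : exists e, forall u c, u \in I -> annI c -> w = u + c -> e = f u.
  have [/JE [u [c [uI ca ->]]]|nw] := pselect (is_true (w \in J)).
    by exists (f u) => u' c' uI' ca' e; rewrite (uniq u c u' c').
  exists 0 => u c uI ca wuc; case: nw; apply/JE; by exists u, c.
have [|a w w' /JE [u [c [uI ca ->]]] /JE [u' [c' [uI' ca' ->]]]|m mE] := Eext J _ g.
(* If [I] is not inside [P i], a multiple of [x i] outside [P i] lies in [I]; otherwise [x i] itself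
   kills [I]. The sum of these elements avoids all the primes. *)
- have /choice [y yP] i : exists y, [/\ y \in J, forall j, j != i -> y \in P j & y \notin P i].
    have [[a aI aP]|nI] := pselect (exists2 a, a \in I & a \notin P i).
      exists (a * x i); split=> [|j ji|]; last by rewrite prime_idealrM negb_or aP xnP.
        by rewrite mulrC; apply/IJ/ideal_mul.
      by rewrite idealMr // xP // eq_sym.
    exists (x i); split=> // [|j ji]; last by rewrite xP // eq_sym.
    apply: annJ => u uI; apply: P0 => j; rewrite prime_idealrM.
    have [<-|ij] := eqVneq i j; last by rewrite xP.
    by apply/orP; right; apply: contrapT => /negP uP; apply: nI; exists u.
  exists (\sum_i y i); first by apply: rpred_sum => i _; have [] := yP i.
  apply: covered_regular P0 _ => i; have [_ _ yi] := yP i.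
  by apply: notin_prime_sum yi => j ji; have [_ yj _] := yP j; apply: yj; rewrite eq_sym.
- rewrite (gE (u + c) u c) // (gE (u' + c') u' c') // (gE _ (a * u + u') (a * c + c')).
  + exact: flin.
  + exact: ideal_lin.
  + by move=> v vI; rewrite mulrDl -mulrA ca // ca' // mulr0 addr0.
  + by rewrite mulrDr addrACA.
- exists m => u uI; rewrite -mE ?IJ //; apply/esym/(gE u u 0) => //; rewrite ?addr0 //.
  by move=> v _; rewrite mul0r.
Qed.

End CoveredInjective.

(** * Modules over T(R[x]) *)

(** A new name for [V], so that the action of [R] through [phi] does not compete with that of
    [B]. *)
Definition restr (R B : comNzRingType) (phi : {rmorphism R -> B}) (V : lmodType B) : Type := V.

Section Restriction.
Variables (R B : comNzRingType) (phi : {rmorphism R -> B}) (V : lmodType B).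

HB.instance Definition _ := GRing.Zmodule.copy (restr phi V) V.

Definition restr_scale (a : R) (v : restr phi V) : restr phi V := phi a *: (v : V).

Fact restr_scaleA a b v : restr_scale a (restr_scale b v) = restr_scale (a * b) v.
Proof. by rewrite /restr_scale scalerA rmorphM. Qed.

Fact restr_scale1 : left_id 1 restr_scale.
Proof. by move=> v; rewrite /restr_scale rmorph1 scale1r. Qed.

Fact restr_scaleDr : right_distributive restr_scale +%R.
Proof. by move=> a u v; apply: (@scalerDr B V). Qed.

Fact restr_scaleDl v : {morph restr_scale^~ v : a b / a + b}.
Proof. by move=> a b; rewrite /restr_scale rmorphD (@scalerDl B V). Qed.

HB.instance Definition _ := GRing.Zmodule_isLmodule.Build R (restr phi V)
  restr_scaleA restr_scale1 restr_scaleDr restr_scaleDl.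

Lemma restr_scaleE (a : R) (v : restr phi V) : a *: v = phi a *: (v : V).
Proof. by []. Qed.

End Restriction.

(** * Annihilation of Ext by annihilators of the first argument *)

Section Annihilation.
Variable R : comNzRingType.

(* [h] is one component of a null-homotopy of multiplication by [a] on [X]. *)
Lemma annihilator_homotopy (A : lmodType R) (X : resolution A) (a : R) :
  (forall i, projective_mod (X i)) -> (forall x : A, a *: x = 0) ->
  forall n, exists h : {linear X n -> X n.+1},
    forall y, res_diff X n (a *: y - h (res_diff X n y)) = 0.
Proof.
move=> Xproj aA; elim=> [|n [h hE]].
  have [|f fE] := @ex_linear R (X 0%N) (X 0%N) (fun x => a *: x).
    by move=> b x y; rewrite scalerDr !scalerA mulrC.
  have [|h hE] := projective_lift (d := res_diff X 0) (f := f) (Xproj 0%N).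
    by move=> x; apply/res_exact0; rewrite fE linearZ; apply: aA.
  by exists h => y; rewrite linearB hE fE linearZ subrr.
have [|f fE] := @ex_linear R (X n.+1) (X n.+1) (fun y => a *: y - h (res_diff X n y)).
  move=> b x y; rewrite (linearP (res_diff X n)) (linearP h) scalerDr opprD addrACA scalerBr.
  by rewrite !scalerA mulrC.
have [|k kE] := projective_lift (d := res_diff X n.+1) (f := f) (Xproj n.+1).
  by move=> x; apply/res_exactS; rewrite fE hE.
exists k => z; rewrite linearB kE fE linearZ.
have -> : res_diff X n (res_diff X n.+1 z) = 0 by apply/res_exactS; exists z.
by rewrite linear0 subr0 subrr.
Qed.

(** With the homotopy [h], the difference of [a *: y] and [h (res_diff X n y)] is a boundary, which
    [f] kills; so [s] is [f] after [h]. *)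
Lemma Ext_annihilated (A N : lmodType R) (X : resolution A) (a : R) n
    (f : {linear X n.+1 -> N}) :
  (forall i, projective_mod (X i)) -> (forall x : A, a *: x = 0) ->
  (forall y, f (res_diff X n.+1 y) = 0) ->
  exists s : {linear X n -> N}, forall y, a *: f y = s (res_diff X n y).
Proof.
move=> Xproj aA fd; have [h hE] := annihilator_homotopy Xproj aA n.
have [|s sE] := @ex_linear R (X n) N (fun x => f (h x)).
  by move=> b x y; rewrite !linearP.
exists s => y; have /res_exactS [z dz] := hE y.
by apply/eqP; rewrite sE -linearZ -subr_eq0 -linearB -dz fd.
Qed.

End Annihilation.

Section TotalQuotModules.
Variable R : comNzRingType.
Local Notation T := (total_quot {poly R}).

Definition to_TRx : {rmorphism R -> T} := @to_total_quot {poly R} \o @polyC R.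

Lemma to_TRx_inj : injective to_TRx.
Proof. by move=> a b /emb_inj /polyC_inj. Qed.

(** The polynomial with the dense generators as coefficients is regular by McCoy's theorem;
    expanding its product with its inverse gives the relation. *)
Lemma semiregular_unit (I : submodClosed R^o) : semiregular_ideal I ->
  exists (n : nat) (g : 'I_n -> R) (t : 'I_n -> T),
    (forall k, g k \in I) /\ \sum_k t k * to_TRx (g k) = 1.
Proof.
case=> J [sJI [n [g gJ]] Jdense].
pose G : {poly R} := \sum_(k < n) (g k)%:P * 'X^k.
have GE (k : 'I_n) : G`_k = g k.
  rewrite coef_sum (bigD1 k) //= coefCM coefXn eqxx mulr1 big1 ?addr0 // => l lk.
  by rewrite coefCM coefXn (_ : (_ == _) = false) ?mulr0 // eq_sym; apply: negPf.
have [|t Gt] := emb_unit (s := G).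
  apply: mccoy => r Gr; apply: Jdense => j /gJ [c ->].
  rewrite mulr_suml big1 // => k _; rewrite -mulrA (_ : g k * r = 0) ?mulr0 //.
  by rewrite -GE.
exists n, g, (fun k => to_total_quot 'X^k * t); split=> [k|].
  apply/sJI/gJ; exists (fun l => (l == k)%:R).
  rewrite (bigD1 k) //= eqxx mul1r big1 ?addr0 // => l /negPf ->.
  by rewrite mul0r.
rewrite -Gt rmorph_sum mulr_suml; apply: eq_bigr => k _.
by rewrite rmorphM /=; ring.
Qed.

Variable V : lmodType T.
Local Notation RV := (restr to_TRx V).

Lemma restr_Ext_vanishes (I : submodClosed R^o) n :
  semiregular_ideal I -> Ext_vanishes n.+1 (cyclic_mod I) RV.
Proof.
move=> /semiregular_unit [m [g [t [gI gt]]]] X Xproj f fd.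
have /choice [s sE] k : exists s : {linear X n -> RV},
    forall y, g k *: f y = s (res_diff X n y).
  apply: Ext_annihilated => // x; rewrite -(quotmod_projK x).
  rewrite -[LHS](@quotmod_projZ R R^o I) -(linear0 (@quotmod_proj R R^o I)).
  apply/quotmod_eqP; rewrite subr0 /GRing.scale /= mulrC.
  exact: ideal_mul.
(* Each [g k *: f] is bounded by [s k]. As [V] is a module over [T], these maps can be recombined
   with the coefficients [t k] of the relation for 1. *)
have [|h hE] := @ex_linear R (X n) RV (fun x => \sum_k t k *: (s k x : V)).
  move=> a x y; rewrite restr_scaleE scaler_sumr -big_split /=.
  apply: eq_bigr => k _; rewrite linearP restr_scaleE scalerDr.
  by rewrite !scalerA mulrC.
exists h => y; rewrite hE -[LHS](@scale1r T V) -gt scaler_suml.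
by apply: eq_bigr => k _; rewrite -sE restr_scaleE scalerA.
Qed.

Lemma restr_Q_torsion_free : Q_torsion_free RV.
Proof.
move=> I v [_ /semiregular_unit [m [g [t [gI gt]]]]] Iv.
rewrite -[LHS](@scale1r T V) -gt scaler_suml big1 // => k _.
by rewrite -scalerA -restr_scaleE Iv // (@scaler0 T V).
Qed.

Lemma restr_strongly_Lucas : strongly_Lucas_mod RV.
Proof.
split; first exact: restr_Q_torsion_free.
by move=> I [//|n] [_ Isr] _; apply: restr_Ext_vanishes.
Qed.

End TotalQuotModules.

(** * The equivalences *)

Lemma square_zero_reduced (A : comNzRingType) :
  (forall a : A, a * a = 0 -> a = 0) -> reduced_ring A.
Proof.
move=> red2 x n xn; have {xn} : x ^+ (2 ^ n) = 0.
  by rewrite -(subnKC (ltnW (ltn_expl n (ltnSn 1)))) exprD xn mul0r.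
elim: n => [|n IH]; first by rewrite expn0 expr1.
by rewrite expnSr exprM expr2 => /red2 /IH.
Qed.

(** * Consequences of injectivity of T(R[x])-modules over R *)

Section InjectiveModules.
Variable R : comNzRingType.
Local Notation T := (total_quot {poly R}).
Local Notation phi := (to_TRx R).

Hypothesis T_injective : forall V : lmodType T, injective_mod (restr phi V).

(** The inclusion of aR into aT extends to R, so a = a m with m = a t, and therefore a = a^2 t =
    0. *)
Lemma restr_injective_reduced : reduced_ring R.
Proof.
apply: square_zero_reduced => a aa0.
have [||S SE] := @ex_submod T T^o (fun u : T => exists t, u = phi a * t).
- by exists 0; rewrite mulr0.
- move=> c _ _ [t ->] [t' ->]; exists (c * t + t').
  by rewrite mulrDr /GRing.scale /= mulrCA.
have [||I IE] := @ex_submod R R^o (fun x : R => exists r, x = a * r).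
- by exists 0; rewrite mulr0.
- move=> c _ _ [r ->] [r' ->]; exists (c * r + r').
  by rewrite mulrDr /GRing.scale /= mulrCA.
have /choice [f fE] (x : R) : exists v : submod S, x \in I -> submod_val v = phi x.
  have [/IE [r ->]|nx] := pselect (is_true (x \in I)); last by exists 0.
  have aS : (phi (a * r) : T^o) \in S by apply/SE; exists (phi r); rewrite rmorphM.
  by exists (Submod aS).
have [|m mE] := injective_extends (I := I) (@T_injective (submod S)) (f := f).
  move=> c x y xI yI; apply: val_inj; transitivity (phi (c * x + y)).
    by apply: fE; apply: ideal_lin.
  by rewrite (rmorphD phi) (rmorphM phi) -(fE x) // -(fE y).
have aI : a \in I by apply/IE; exists 1; rewrite mulr1.
have [t mt] : exists t, submod_val m = phi a * t by apply/SE/(valP (m : submod S)).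
apply: to_TRx_inj; rewrite (rmorph0 phi) -fE // mE //.
transitivity (phi a * submod_val m); first by [].
by rewrite mt mulrA -(rmorphM phi) aa0 (rmorph0 phi) mul0r.
Qed.

Lemma restr_injective_orthogonal (b : nat -> R) :
  (forall i j, i != j -> b i * b j = 0) -> exists i, b i = 0.
Proof.
move=> b_orth.
have [||I IE] := @ex_submod R R^o (fun x : R => exists N, forall i, (N <= i)%N -> b i * x = 0).
- by exists 0%N => i _; rewrite mulr0.
- move=> c x y [N Nx] [N' Ny]; exists (maxn N N') => i; rewrite geq_max => /andP[/Nx bx /Ny by0].
  by rewrite mulrDr /GRing.scale /= mulrCA bx by0 mulr0 addr0.
(* [{poly T}] plays the direct sum of countably many copies of [T]: for [x] in [I] almost all
   [b i * x] vanish. *)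
have /choice [f fE] (x : R) : exists p : {poly T},
    x \in I -> forall i, p`_i = phi (b i * x).
  have [/IE [N Nx]|nx] := pselect (is_true (x \in I)); last by exists 0.
  exists (\poly_(i < N) phi (b i * x)) => _ i; rewrite coef_poly.
  by case: ltnP => // /Nx ->; rewrite rmorph0.
have [|m mE] := injective_extends (I := I) (@T_injective {poly T}) (f := f).
  move=> c x y xI yI; apply/polyP => i; rewrite fE.
    transitivity ((phi c *: f x + f y)`_i); last by [].
    by rewrite mulrDr mulrCA (rmorphD phi) coefD coefZ (fE x) // (fE y) // -(rmorphM phi).
  exact: ideal_lin.
have bI j : b j \in I.
  by apply/IE; exists j.+1 => i ji; rewrite b_orth // gtn_eqF.
(* The coefficient of [m] at its own size is 0; evaluating at [b j] for this index gives
   [b j * b j = 0]. *)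
exists (size (m : {poly T})); set j := size _.
apply: (restr_injective_reduced (n := 2)); apply: to_TRx_inj.
rewrite rmorph0 expr2 -fE // mE // coefZ nth_default ?mulr0 //.
Qed.

Lemma restr_injective_covered : covered (fun _ : R => True).
Proof.
apply: reduced_orthogonal_covered; first exact: restr_injective_reduced.
exact: restr_injective_orthogonal.
Qed.

End InjectiveModules.

Section Characterisations.
Variable R : comNzRingType.
Local Notation finite_primes := (covered (fun _ : R => True)).

Lemma regular_semiregular (I : submodClosed R^o) : regular_ideal I -> semiregular_ideal I.
Proof.
case=> s sI /in_Q_principal [J QJ JE]; exists J; split; [|exact: QJ.1|exact: in_Q_dense].
by move=> x /JE [c ->]; apply: ideal_mul.
Qed.

(** The map extends from the principal ideal of a regular element; on the rest of [I] the error is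
    killed by that ideal, so it vanishes by torsion-freeness. *)
Lemma Lucas_extends (M : lmodType R) : Lucas_mod M ->
  forall I, regular_ideal I -> extends_from I M.
Proof.
move=> [Mtf Mext] I [s sI sreg] f flin.
have [J QJ JE] := in_Q_principal sreg.
have JI : {subset J <= I}.
  by move=> x /JE [c ->]; apply: ideal_mul.
have [|m mE] := Ext1_extends (Mext J QJ) (f := f).
  by move=> a x y /JI xI /JI; apply: flin.
exists m => x xI; apply/eqP; rewrite -subr_eq0; apply/eqP/(Mtf J) => // r rJ.
have f0 : f 0 = 0.
  have := flin (-1) 0 0 (rpred0 _) (rpred0 _).
  by rewrite mulr0 addr0 scaleN1r addNr.
have fZ a u : u \in I -> f (a * u) = a *: f u.
  by move=> uI; have := flin a u 0 uI (rpred0 _); rewrite f0 !addr0.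
rewrite scalerBr -fZ // mulrC fZ ?JI // mE // !scalerA mulrC subrr //.
Qed.

Lemma finite_primes_reg_injective : finite_primes ->
  forall M : lmodType R, reg_injective M -> injective_mod M.
Proof.
by move=> cR M Mreg; apply: covered_injective cR _ => I /Mreg /Ext1_extends.
Qed.

Lemma finite_primes_Lucas : finite_primes ->
  forall M : lmodType R, Lucas_mod M -> injective_mod M.
Proof. by move=> cR M ML; apply: covered_injective cR (Lucas_extends ML). Qed.

Lemma finite_primes_total_quot : finite_primes <-> semisimple_ring (total_quot R).
Proof.
split; first exact: total_quot_semisimple.
exact: (semisimple_covered (phi := @to_total_quot R) (@emb_inj R)).
Qed.

(** The augmentation is an isomorphism from [P 0] to [M]. Composing with its inverse makes a
    projective resolution of [M] one of [P 0], with the same differentials. *)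
Lemma zero_tauq_projective_dim (M : lmodType R) : has_tauq_resolution M 0 -> tauq_projective M.
Proof.
case=> P [Pproj P0] N NL X Xproj.
have P1 : forall x : P 1%N, x = 0 by apply: P0.
have aug_inj x y : res_aug P x = res_aug P y -> x = y.
  move/eqP; rewrite -subr_eq0 -linearB => /eqP /res_exact0 [z].
  by rewrite (P1 z) linear0 => /esym /eqP; rewrite subr_eq0 => /eqP.
have [x|x y y' <-|a x x' y y' <- <-|e eE] :=
    @choice_linear R M (P 0%N) (fun x y => res_aug P y = x).
- exact: res_aug_surj.
- by move/aug_inj.
- exact: linearP.
have [|e' e'E] := @ex_linear R (X 0%N) (P 0%N) (e \o res_aug X).
  by move=> a x y; rewrite /= !linearP.
have e'surj : surjective_map e'.
  move=> y; have [x xE] := res_aug_surj X (res_aug P y); exists x.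
  by apply: aug_inj; rewrite e'E /= eE.
have e'ex x : e' x = 0 <-> exists y, res_diff X 0 y = x.
  rewrite -res_exact0 e'E /=; split=> [ex0|->]; last exact: linear0.
  by rewrite -[LHS]eE ex0 linear0.
exact: (Pproj 0%N isT N NL (Resolution e'surj e'ex (@res_exactS _ _ X)) Xproj).
Qed.

Lemma tauq_projective_zero_dim (M : lmodType R) : tauq_projective M -> has_tauq_resolution M 0.
Proof.
move=> Mproj.
(* [M] in degree 0 and the zero module ['rV[R]_0] above it. *)
pose X n : lmodType R := if n is 0 then M else 'rV[R]_0.
have Xaug : surjective_map (idfun : M -> M) by move=> x; exists x.
have X0 n (x : X n.+1) : x = 0 by apply/rowP => -[].
have ex0 (x : X 0%N) : idfun x = 0 <-> exists y : X 1%N, (\0 : {linear X 1%N -> X 0%N}) y = x.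
  by split=> [x0|[y <-]] //; exists 0; rewrite linear0; apply: esym x0.
have exS n (x : X n.+1) : (\0 : {linear X n.+1 -> X n}) x = 0 <->
    exists y : X n.+2, (\0 : {linear X n.+2 -> X n.+1}) y = x.
  by split=> // _; exists 0; rewrite (X0 n x).
exists (@Resolution R M X (fun n => \0 : {linear X n.+1 -> X n})
  (idfun : {linear M -> M}) Xaug ex0 exS).
by split=> [[|i]|[|i]] //= _ x; apply: (X0 i).
Qed.

Lemma least_eq0 (p : nat -> Prop) : least p = Some 0%N <-> p 0%N.
Proof.
rewrite /least; case: pselect => [h|nh]; last first.
  by split=> // p0; case: nh; exists 0%N; apply/asboolP.
case: ex_minnP => m /asboolP pm mmin; split=> [[m0]|p0]; first by rewrite -m0.
by congr Some; apply/eqP; rewrite -leqn0 mmin //; apply/asboolP.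
Qed.

Lemma tauq_semisimpleE : tauq_semisimple R <-> forall M : lmodType R, tauq_projective M.
Proof.
rewrite /tauq_semisimple /tauq_gldim least_eq0; split=> h M.
  apply: zero_tauq_projective_dim; have [m pdm m0] := h M.
  by apply/least_eq0; move: m0 pdm; rewrite leqn0 => /eqP ->.
by exists 0%N => //; apply/least_eq0/tauq_projective_zero_dim.
Qed.

(** Vanishing of Ext^1 against the cyclic modules R/I is already Baer's criterion. *)
Lemma tauq_projective_allE : (forall M : lmodType R, tauq_projective M) <->
  (forall M : lmodType R, strongly_Lucas_mod M -> injective_mod M).
Proof.
split=> h M; last by move=> N /h /injective_Ext1; apply.
by move=> ML; apply: baer_criterion => I; apply: Ext1_extends; apply: h.
Qed.

End Characterisations.

Theorem theorem4p3 (R : comNzRingType) :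
  [<-> tauq_semisimple R;
       forall M : lmodType R, tauq_projective M;
       semisimple_ring (total_quot {poly R});
       reduced_ring {poly R} /\ finitely_many_minimal_primes {poly R};
       semisimple_ring (total_quot R);
       reduced_ring R /\ finitely_many_minimal_primes R;
       forall M : lmodType R, reg_injective M -> injective_mod M;
       forall M : lmodType R, semireg_injective M -> injective_mod M;
       forall M : lmodType R, Lucas_mod M -> injective_mod M;
       forall M : lmodType R, strongly_Lucas_mod M -> injective_mod M;
       semisimple_ring (finite_fractions R)].
Proof.
have cP : covered (fun _ : {poly R} => True) <-> covered (fun _ : R => True).
  split; last exact: covered_poly.
  exact: (covered_contraction (phi := polyC) (@polyC_inj R)).
have c_min (A : comNzRingType) : covered (fun _ : A => True) <->
    reduced_ring A /\ finitely_many_minimal_primes A.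
  by split=> [/covered_reduced_min //|[red fin]]; apply: reduced_min_covered.
have sL : (forall M : lmodType R, strongly_Lucas_mod M -> injective_mod M) ->
    covered (fun _ : R => True).
  by move=> h; apply: restr_injective_covered => V; apply/h/restr_strongly_Lucas.
have sLE (M : lmodType R) : strongly_Lucas_mod M -> Lucas_mod M by move=> [? h]; split=> // I QI; apply: h.
(* One cycle of implications in the listed order. All but (1) to (2), (7) to (8) and (9) to (10)
   pass through [covered]. *)
tfae.
- by move/tauq_semisimpleE.
- by move/tauq_projective_allE/sL/cP/finite_primes_total_quot.
- by move/finite_primes_total_quot/c_min.
- by move/c_min/cP/finite_primes_total_quot.
- by move/finite_primes_total_quot/c_min.
- by move/c_min/finite_primes_reg_injective.
- move=> h M Mreg; apply: h => I /regular_semiregular; exact: Mreg.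
(* Modules over T(R[x]) are semireg-injective, hence injective over [R] by hypothesis. *)
- move=> h; apply: finite_primes_Lucas; apply: restr_injective_covered => V.
  by apply: h => I; apply: restr_Ext_vanishes.
- by move=> h M /sLE /h.
- by move/sL/finite_fractions_semisimple.
- move/(semisimple_covered (@Q0_emb_inj R)) => cR; apply/tauq_semisimpleE/tauq_projective_allE.
  by move=> M /sLE; apply: finite_primes_Lucas.
Qed.
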